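(* Let $R$ be a commutative noetherian local ring and $\boldsymbol{x}=x_1,\cdots,x_d$ an $R$-regular sequence, and let $M$ be a nonzero finitely generated $R/(\boldsymbol{x})$-module. If $\mathrm{Ext}^{1}_R(M,M)=0$, then $\mathrm{qpd}_{R}M<\infty$ if and only if $\mathrm{qpd}_{R/(\boldsymbol{x})}M<\infty$.
   Context: An $R/(\boldsymbol x)$-module is regarded as an $R$-module by restriction of scalars; modules are viewed as complexes in degree $0$. For a ring $S$, complexes are homologically graded, $\mathrm{H}_n$ denotes homology, $\mathrm{H}(M)=\bigoplus_n\mathrm{H}_n(M)$, $\sup P=\sup\{i:P_i\neq0\}$, $\mathrm{hsup}P=\sup\{i:\mathrm{H}_i(P)\ne0\}$, and $\Sigma$ is the shift with $\mathrm{H}_n(\Sigma^iM)=\mathrm{H}_{n-i}(M)$. An $S$-complex $P$ is semi-projective if $\mathrm{Hom}_S(P,\beta)$ is a surjective quasi-isomorphism for every surjective quasi-isomorphism $\beta$ of $S$-complexes. A quasi-projective resolution of an $S$-complex $M$ is a semi-projective $S$-complex $P$ for which there are an integer $\ell$ and integers $a_i\ge0$ ($i\ge\ell$), not all zero, with $\mathrm{H}(P)\cong\bigoplus_{i=\ell}^\infty\mathrm{H}(\Sigma^iM^{a_i})$ (as graded modules). $\mathrm{qpd}_SM$ is the infimum of $\sup P-\mathrm{hsup}P$ over all bounded above (i.e. $P_v=0$ for $v\gg0$) quasi-projective resolutions $P$ of $M$ if $M$ is not exact ($\infty$ if there are none), and $-\infty$ if $M$ is exact. *)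

(* Defs.v *)
From HB Require Import structures.
From mathcomp Require Import all_boot all_order all_algebra.
From mathcomp Require Import generic_quotient ring_quotient.
From mathcomp Require Import boolp classical_sets functions cardinality.
From mathcomp Require Import constructive_ereal.

Set Implicit Arguments.
Unset Strict Implicit.
Unset Printing Implicit Defensive.

Import Order.TTheory GRing.Theory Num.Theory.
Local Open Scope ring_scope.

Section Submod.
Variables (S : comNzRingType) (V : lmodType S) (N : submodClosed V).

Record submod := Submod { submod_val :> V; submod_valP : submod_val \in N }.

HB.instance Definition _ := [isSub for submod_val].
HB.instance Definition _ := [Choice of submod by <:].
HB.instance Definition _ := [SubChoice_isSubLmodule of submod by <:].

End Submod.

Section Quotmod.
Variables (S : comNzRingType) (V : lmodType S) (N : submodClosed V).

(* The library derives closure under subtraction when a [submodClosed] is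
   declared but does not recover it from one, so the zmodClosed instance that
   {ideal_quot _} needs is rebuilt here. *)
Definition zmod_of_submod : {pred V} := N.

HB.instance Definition _ :=
  GRing.isZmodClosed.Build V zmod_of_submod (GRing.submod_closedB (submodClosedP N)).

Local Notation Q := {ideal_quot zmod_of_submod}.

Definition quotmod : Type := Q.

Definition quotmod_repr (q : quotmod) : V := repr (q : Q).

HB.instance Definition _ := GRing.Zmodule.on quotmod.

Definition quotmod_pi (v : V) : quotmod := \pi_Q%qT v.

Definition quotmod_scale (a : S) (q : quotmod) : quotmod :=
  quotmod_pi (a *: quotmod_repr q).

Lemma quotmod_piP (u v : V) : quotmod_pi u = quotmod_pi v <-> u - v \in N.
Proof.
have E : (u - v \in N) = (\pi_Q u == \pi_Q v)%qT := 
    Quotient.idealrBE (zmod_of_submod : zmodClosed V) u v.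
by split=> [/eqP|h]; [rewrite E | apply/eqP; rewrite -E].
Qed.

Lemma quotmod_reprK (q : quotmod) : quotmod_pi (quotmod_repr q) = q.
Proof. exact: reprK. Qed.

Lemma quotmod_piD (u v : V) : quotmod_pi (u + v) = quotmod_pi u + quotmod_pi v.
Proof. exact: (raddfD (\pi_Q%qT)). Qed.

Lemma quotmod_piZ a (v : V) : quotmod_scale a (quotmod_pi v) = quotmod_pi (a *: v).
Proof.
apply/quotmod_piP; rewrite -scalerBr rpredZ //; apply/quotmod_piP.
exact: quotmod_reprK.
Qed.

Fact quotmod_scaleA a b q :
  quotmod_scale a (quotmod_scale b q) = quotmod_scale (a * b) q.
Proof. by rewrite -[q]quotmod_reprK !quotmod_piZ scalerA. Qed.
Fact quotmod_scale1 : left_id 1 quotmod_scale.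
Proof. by move=> q; rewrite -[q]quotmod_reprK quotmod_piZ scale1r. Qed.
Fact quotmod_scaleDr : right_distributive quotmod_scale +%R.
Proof.
move=> a p q; rewrite -[p]quotmod_reprK -[q]quotmod_reprK.
by rewrite -quotmod_piD !quotmod_piZ -quotmod_piD scalerDr.
Qed.
Fact quotmod_scaleDl q : {morph quotmod_scale^~ q : a b / a + b}.
Proof.
by move=> a b; rewrite -[q]quotmod_reprK !quotmod_piZ -quotmod_piD scalerDl.
Qed.

HB.instance Definition _ := GRing.Zmodule_isLmodule.Build S quotmod
  quotmod_scaleA quotmod_scale1 quotmod_scaleDr quotmod_scaleDl.

Fact quotmod_pi_linear : linear quotmod_pi.
Proof. by move=> a u v; rewrite quotmod_piD -quotmod_piZ. Qed.

HB.instance Definition _ :=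
  GRing.isLinear.Build S V quotmod *:%R quotmod_pi quotmod_pi_linear.

End Quotmod.

Section DirectProduct.
Variables (S : comNzRingType) (I : Type) (V : I -> lmodType S).

Definition dprod : Type := forall i, V i.

HB.instance Definition _ := Choice.on dprod.

Fact dprod_addA : associative (fun f g : dprod => (fun i => f i + g i) : dprod).
Proof. by move=> f g h; apply: functional_extensionality_dep => i; rewrite addrA. Qed.
Fact dprod_addC : commutative (fun f g : dprod => (fun i => f i + g i) : dprod).
Proof. by move=> f g; apply: functional_extensionality_dep => i; rewrite addrC. Qed.
Fact dprod_add0 :
  left_id ((fun i => 0) : dprod) (fun f g : dprod => (fun i => f i + g i) : dprod).
Proof. by move=> f; apply: functional_extensionality_dep => i; rewrite add0r. Qed.
Fact dprod_addN : left_inverse ((fun i => 0) : dprod) (fun f : dprod => (fun i => - f i) : dprod)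
  (fun f g : dprod => (fun i => f i + g i) : dprod).
Proof. by move=> f; apply: functional_extensionality_dep => i; rewrite addNr. Qed.

HB.instance Definition _ := GRing.isZmodule.Build dprod
  dprod_addA dprod_addC dprod_add0 dprod_addN.

Fact dprod_scaleA a b (f : dprod) :
  (fun i => a *: (b *: f i)) = (fun i => (a * b) *: f i) :> dprod.
Proof. by apply: functional_extensionality_dep => i; rewrite scalerA. Qed.
Fact dprod_scale1 : left_id 1 (fun (a : S) (f : dprod) => (fun i => a *: f i) : dprod).
Proof. by move=> f; apply: functional_extensionality_dep => i; rewrite scale1r. Qed.
Fact dprod_scaleDr :
  right_distributive (fun (a : S) (f : dprod) => (fun i => a *: f i) : dprod) +%R.
Proof. by move=> a f g; apply: functional_extensionality_dep => i; rewrite scalerDr. Qed.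
Fact dprod_scaleDl (f : dprod) : {morph (fun a => (fun i => a *: f i) : dprod) : a b / a + b}.
Proof. by move=> a b; apply: functional_extensionality_dep => i; rewrite scalerDl. Qed.

HB.instance Definition _ := GRing.Zmodule_isLmodule.Build S dprod
  dprod_scaleA dprod_scale1 dprod_scaleDr dprod_scaleDl.

Definition finsupp_pred : {pred dprod} :=
  fun f => `[< finite_set [set i | f i != 0]%classic >].

Fact finsupp_closed : submod_closed finsupp_pred.
Proof.
split=> [|a f g /asboolP Ff /asboolP Fg].
  apply/asboolP; suff -> : [set i | (0 : dprod) i != 0]%classic = set0 by [].
  by apply/seteqP; split=> i //=; rewrite eqxx.
have Fu : finite_set ([set i | f i != 0] `|` [set i | g i != 0])%classic.
  by rewrite finite_setU; split.
apply/asboolP; apply: sub_finite_set Fu => i /= h.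
have [f0|] := eqVneq (f i) 0; last by left.
by right; apply: contra_neq h => g0; rewrite /GRing.add/= /GRing.scale/= f0 g0 scaler0 addr0.
Qed.

HB.instance Definition _ := GRing.isSubmodClosed.Build S dprod finsupp_pred finsupp_closed.

Definition dsum : lmodType S := submod finsupp_pred.

End DirectProduct.

Section RestrictScalars.
Variables (R S : comNzRingType) (f : {rmorphism R -> S}) (M : lmodType S).

(* [f] is kept as a parameter: the R-action below depends on it. *)
Definition restr_scalars : Type := let _ := f in M.

HB.instance Definition _ := GRing.Zmodule.copy restr_scalars M.

Definition restr_scale (a : R) (m : restr_scalars) : restr_scalars := f a *: (m : M).

Fact restr_scaleA a b m : restr_scale a (restr_scale b m) = restr_scale (a * b) m.
Proof. by rewrite /restr_scale scalerA rmorphM. Qed.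
Fact restr_scale1 : left_id 1 restr_scale.
Proof. by move=> m; rewrite /restr_scale rmorph1 scale1r. Qed.
Fact restr_scaleDr : right_distributive restr_scale +%R.
Proof. by move=> a m n; rewrite /restr_scale scalerDr. Qed.
Fact restr_scaleDl m : {morph restr_scale^~ m : a b / a + b}.
Proof. by move=> a b; rewrite /restr_scale rmorphD scalerDl. Qed.

HB.instance Definition _ := GRing.Zmodule_isLmodule.Build R restr_scalars
  restr_scaleA restr_scale1 restr_scaleDr restr_scaleDl.

End RestrictScalars.

Definition surj (A B : Type) (f : A -> B) : Prop := forall b, exists a, f a = b.

Section ModulePredicates.
Variable S : comNzRingType.

Definition zero_mod (V : lmodType S) : Prop := forall v : V, v = 0.

Definition fin_gen (V : lmodType S) : Prop :=
  exists (n : nat) (g : 'I_n -> V),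
    forall v, exists c : 'I_n -> S, v = \sum_i c i *: g i.

Definition isomorphic (U V : lmodType S) : Prop :=
  exists f : {linear U -> V}, bijective f.

Definition projective (Q : lmodType S) : Prop :=
  forall (U V : lmodType S) (b : {linear U -> V}) (f : {linear Q -> V}),
    surj b -> exists g : {linear Q -> U}, forall q, b (g q) = f q.

End ModulePredicates.

(* Homological grading.  The differential is a family [diff i j : X_i -> X_j]
   over all pairs of degrees, zero unless [i = j + 1]; this avoids transporting
   along equalities of degrees. *)
Record complex (S : comNzRingType) := Complex {
  obj :> int -> lmodType S;
  diff : forall i j, {linear obj i -> obj j};
  diff_shape : forall i j, i != j + 1 -> forall x, diff i j x = 0;
  diff_diff : forall i j k x, diff j k (diff i j x) = 0
}.
Arguments diff {S} X i j : rename.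

Record chain_map (S : comNzRingType) (X Y : complex S) := ChainMap {
  cmap :> forall i, {linear X i -> Y i};
  cmap_diff : forall i j x, cmap j (diff X i j x) = diff Y i j (cmap i x)
}.

Section Homology.
Variables (S : comNzRingType) (X : complex S) (n : int).

Definition cycle_pred : {pred X n} := fun x => diff X n (n - 1) x == 0.

Fact cycle_closed : submod_closed cycle_pred.
Proof.
split=> [|a x y]; rewrite /in_mem /= /cycle_pred ?linear0 // => /eqP dx /eqP dy.
by rewrite linearP dx dy scaler0 addr0.
Qed.

HB.instance Definition _ := GRing.isSubmodClosed.Build S (X n) cycle_pred cycle_closed.

Definition cycles : lmodType S := submod cycle_pred.

Definition boundary_pred : {pred cycles} :=
  fun z => `[< exists y, diff X (n + 1) n y = submod_val z >].

Fact boundary_closed : submod_closed boundary_pred.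
Proof.
split=> [|a u v /asboolP [x dx] /asboolP [y dy]]; apply/asboolP.
  by exists 0; rewrite !linear0.
by exists (a *: x + y); rewrite !linearP dx dy.
Qed.

HB.instance Definition _ :=
  GRing.isSubmodClosed.Build S cycles boundary_pred boundary_closed.

Definition homology : lmodType S := quotmod boundary_pred.

End Homology.

Section HomologyMap.
Variables (S : comNzRingType) (X Y : complex S) (f : chain_map X Y) (n : int).

Fact cycle_map_subproof (z : cycles X n) : f n (submod_val z) \in @cycle_pred S Y n.
Proof.
by rewrite /in_mem /= /cycle_pred -cmap_diff (eqP (submod_valP z)) linear0.
Qed.

Definition cycle_map (z : cycles X n) : cycles Y n := Submod (cycle_map_subproof z).

Definition homology_map (h : homology X n) : homology Y n :=
  quotmod_pi _ (cycle_map (quotmod_repr h)).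

Lemma homology_map_pi (z : cycles X n) :
  homology_map (quotmod_pi _ z) = quotmod_pi _ (cycle_map z).
Proof.
apply/quotmod_piP.
have /quotmod_piP/asboolP [y dy] := @quotmod_reprK _ _ (@boundary_pred S X n) (quotmod_pi _ z).
by apply/asboolP; exists (f _ y); rewrite -cmap_diff dy !raddfB.
Qed.

End HomologyMap.

Section ComplexPredicates.
Variable S : comNzRingType.

Definition exact (X : complex S) : Prop := forall n, zero_mod (homology X n).

Definition cmap_surj (X Y : complex S) (f : chain_map X Y) : Prop :=
  forall n, surj (f n).

Definition quasi_iso (X Y : complex S) (f : chain_map X Y) : Prop :=
  forall n, bijective (@homology_map S X Y f n).

Definition bounded_above (X : complex S) : Prop :=
  exists b : int, forall v, b < v -> zero_mod (X v).

(* The supremum of the empty set is -oo. *)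
Definition csup (X : complex S) : \bar int :=
  supremum -oo%E [set i%:E | i in [set i | ~ zero_mod (X i)]]%classic.

Definition hsup (X : complex S) : \bar int :=
  supremum -oo%E [set i%:E | i in [set i | ~ zero_mod (homology X i)]]%classic.

End ComplexPredicates.

Section Shift.
Variables (S : comNzRingType) (k : int) (X : complex S).

Definition shift_diff i j : {linear X (i - k) -> X (j - k)} :=
  (-1) ^+ `|k|%N \*: diff X (i - k) (j - k).

Fact shift_shape i j : i != j + 1 -> forall x, shift_diff i j x = 0.
Proof.
move=> ij x; rewrite /shift_diff /= diff_shape ?scaler0 //.
by apply: contra ij => /eqP h; rewrite -[i](subrK k) h addrAC subrK.
Qed.

Fact shift_diff_diff i j l x : shift_diff j l (shift_diff i j x) = 0.
Proof. by rewrite /shift_diff /= linearZ_LR diff_diff !scaler0. Qed.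

Definition shift : complex S :=
  @Complex S (fun i => X (i - k)) shift_diff shift_shape shift_diff_diff.

End Shift.

Section Power.
Variables (S : comNzRingType) (X : complex S) (a : nat).

Definition power_diff i j (v : {ffun 'I_a -> X i}) : {ffun 'I_a -> X j} :=
  [ffun t => diff X i j (v t)].

Fact power_diff_linear i j : linear (@power_diff i j).
Proof. by move=> c u v; apply/ffunP => t; rewrite !ffunE linearP. Qed.

HB.instance Definition _ i j := GRing.isLinear.Build S
  {ffun 'I_a -> X i} {ffun 'I_a -> X j} *:%R (@power_diff i j) (@power_diff_linear i j).

Fact power_shape i j : i != j + 1 -> forall x, @power_diff i j x = 0.
Proof. by move=> ij x; apply/ffunP => t; rewrite !ffunE diff_shape. Qed.

Fact power_diff_diff i j k x : @power_diff j k (@power_diff i j x) = 0.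
Proof. by apply/ffunP => t; rewrite !ffunE diff_diff. Qed.

Definition power : complex S :=
  @Complex S (fun i => {ffun 'I_a -> X i}) (fun i j => @power_diff i j)
    power_shape power_diff_diff.

End Power.

Section ModuleComplex.
Variables (S : comNzRingType) (M : lmodType S).

Definition mod_obj (i : int) : lmodType S := if i == 0 then M else 'rV[S]_0.

Definition mod_complex : complex S :=
  @Complex S mod_obj (fun i j => (\0 : {linear mod_obj i -> mod_obj j}))
    (fun _ _ _ _ => erefl) (fun _ _ _ _ => erefl).

End ModuleComplex.

Section HomComplex.
Variables (S : comNzRingType) (P X : complex S).

Definition hom_family : lmodType S :=
  dprod (fun i : int => dprod (fun j : int => (P i -> X j) : lmodType S)).

(* Degree n: the linear maps P_i -> X_(i + n), padded with zeros off those
   bidegrees as for [diff]. *)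
Definition hom_pred (n : int) : {pred hom_family} := fun f =>
  `[< (forall i j, linear (f i j)) /\
      (forall i j, j != i + n -> forall x, f i j x = 0) >].

Fact hom_closed n : submod_closed (hom_pred n).
Proof.
split=> [|a f g /asboolP [lf sf] /asboolP [lg sg]]; apply/asboolP; split.
- by move=> i j c u v; rewrite [RHS]addr0 scaler0.
- by [].
- move=> i j c u v.
  change (a *: f i j (c *: u + v) + g i j (c *: u + v) =
    c *: (a *: f i j u + g i j u) + (a *: f i j v + g i j v)).
  rewrite lf lg !scalerDr !scalerA [a * c]mulrC -!addrA; congr (_ + _).
  by rewrite addrCA.
- move=> i j ij x; change (a *: f i j x + g i j x = 0).
  by rewrite sf // sg // scaler0 addr0.
Qed.

HB.instance Definition _ n :=
  GRing.isSubmodClosed.Build S hom_family (hom_pred n) (hom_closed n).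

Definition hom_obj (n : int) : lmodType S := submod (hom_pred n).

(* d(f) = d o f - (-1)^n f o d *)
Definition hom_diff_fun (n : int) (f : hom_family) : hom_family := fun i k x =>
  diff X (k + 1) k (f i (k + 1) x)
    - (-1) ^+ `|n|%N *: f (i - 1) k (diff P i (i - 1) x).
Arguments hom_diff_fun n f _ _ _ : clear implicits.

Fact hom_diff_subproof n m (f : hom_obj n) :
  (if n == m + 1 then hom_diff_fun n (submod_val f) else 0) \in hom_pred m.
Proof.
case: eqP => [nm|_]; last exact: rpred0.
have /asboolP [lf sf] := submod_valP f.
apply/asboolP; split=> [i k c u v|i k ki x]; rewrite /hom_diff_fun.
  rewrite lf !linearP lf scalerDr scalerBr !scalerA [_ * c]mulrC opprD.
  by rewrite addrACA.
have e1 : k + 1 != i + n by rewrite nm addrA (inj_eq (addIr 1)).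
have e2 : k != i - 1 + n by rewrite nm [m + 1]addrC addrA subrK.
by rewrite (sf _ _ e1) (sf _ _ e2) linear0 scaler0 subr0.
Qed.

Definition hom_diff n m (f : hom_obj n) : hom_obj m := Submod (hom_diff_subproof m f).

Fact hom_diff_linear n m : linear (@hom_diff n m).
Proof.
move=> a f g; apply: val_inj => /=.
case: eqP => _; last by rewrite scaler0 addr0.
apply: functional_extensionality_dep => i.
apply: functional_extensionality_dep => k.
apply: functional_extensionality_dep => x.
set s : S := (-1) ^+ `|n|%N.
change (diff X (k + 1) k (a *: submod_val f i (k + 1) x + submod_val g i (k + 1) x)
    - s *: (a *: submod_val f (i - 1) k (diff P i (i - 1) x)
            + submod_val g (i - 1) k (diff P i (i - 1) x))
  = a *: hom_diff_fun n (submod_val f) i k x + hom_diff_fun n (submod_val g) i k x).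
rewrite /hom_diff_fun -/s linearP scalerDr scalerBr !scalerA [s * a]mulrC opprD.
by rewrite addrACA.
Qed.

HB.instance Definition _ n m := GRing.isLinear.Build S
  (hom_obj n) (hom_obj m) *:%R (@hom_diff n m) (@hom_diff_linear n m).

Fact hom_shape n m : n != m + 1 -> forall f, @hom_diff n m f = 0.
Proof. by move=> nm f; apply: val_inj; rewrite /= (negPf nm). Qed.

Fact hom_diff_diff n m l f : @hom_diff m l (@hom_diff n m f) = 0.
Proof.
have /asboolP [lf _] := submod_valP f.
apply: val_inj => /=; case: eqP => // ml; case: eqP => nm; last first.
  apply: functional_extensionality_dep => i.
  apply: functional_extensionality_dep => k.
  apply: functional_extensionality_dep => x.
  change (diff X (k + 1) k 0 - (-1) ^+ `|m|%N *: (0 : X k) = 0).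
  by rewrite linear0 scaler0 subr0.
apply: functional_extensionality_dep => i.
apply: functional_extensionality_dep => k.
apply: functional_extensionality_dep => x.
have f0 : submod_val f (i - 1 - 1) k 0 = 0.
  by have := lf (i - 1 - 1) k (-1) 0 0; rewrite scaler0 addr0 scaleN1r addNr.
have sE : (-1) ^+ `|n|%N = - (-1) ^+ `|m|%N :> S.
  by rewrite nm; case: (m) => [k'|[|k']];
    rewrite /= ?addn1 ?subn1 ?exprS ?mulN1r ?opprK.
change (diff X (k + 1) k (diff X (k + 1 + 1) (k + 1) (submod_val f i (k + 1 + 1) x)
    - (-1) ^+ `|n|%N *: submod_val f (i - 1) (k + 1) (diff P i (i - 1) x))
  - (-1) ^+ `|m|%N *: (diff X (k + 1) k (submod_val f (i - 1) (k + 1) (diff P i (i - 1) x))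
    - (-1) ^+ `|n|%N *:
        submod_val f (i - 1 - 1) k (diff P (i - 1) (i - 1 - 1) (diff P i (i - 1) x)))
  = 0).
rewrite (@diff_diff S P) f0 (linearB (diff X (k + 1) k)) (@diff_diff S X) /=.
rewrite (linearZ_LR (diff X (k + 1) k)) sE scaler0 subr0 sub0r scaleNr opprK.
exact: subrr.
Qed.

Definition hom_complex : complex S :=
  @Complex S hom_obj (fun n m => @hom_diff n m) hom_shape hom_diff_diff.

End HomComplex.

Section HomMap.
Variables (S : comNzRingType) (P X Y : complex S) (b : chain_map X Y).

Fact hom_map_subproof n (f : hom_complex P X n) :
  ((fun i j x => b j (submod_val f i j x)) : hom_family P Y) \in @hom_pred S P Y n.
Proof.
have /asboolP [lf sf] := submod_valP f.
apply/asboolP; split=> [i j c u v|i j ij x]; first by rewrite lf linearP.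
by rewrite sf // linear0.
Qed.

Definition hom_map_fun n (f : hom_complex P X n) : hom_complex P Y n :=
  Submod (hom_map_subproof f).

Fact hom_map_linear n : linear (@hom_map_fun n).
Proof.
move=> a f g; apply: val_inj.
apply: functional_extensionality_dep => i.
apply: functional_extensionality_dep => j.
apply: functional_extensionality_dep => x.
exact: linearP.
Qed.

HB.instance Definition _ n := GRing.isLinear.Build S
  (hom_complex P X n) (hom_complex P Y n) *:%R (@hom_map_fun n) (@hom_map_linear n).

Fact hom_map_diff n m f :
  @hom_map_fun m (diff (hom_complex P X) n m f) = diff (hom_complex P Y) n m (hom_map_fun f).
Proof.
apply: val_inj.
apply: functional_extensionality_dep => i.
apply: functional_extensionality_dep => j.
apply: functional_extensionality_dep => x /=.
case: eqP => _; last exact: linear0.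
by rewrite /hom_diff_fun linearB linearZ_LR cmap_diff.
Qed.

Definition hom_map : chain_map (hom_complex P X) (hom_complex P Y) :=
  @ChainMap S (hom_complex P X) (hom_complex P Y) (fun n => @hom_map_fun n) hom_map_diff.

End HomMap.

Section QuasiProjective.
Variable S : comNzRingType.

Definition semi_projective (P : complex S) : Prop :=
  forall (X Y : complex S) (b : chain_map X Y),
    cmap_surj b -> quasi_iso b ->
    cmap_surj (hom_map P b) /\ quasi_iso (hom_map P b).

Definition quasi_projective_resolution (P M : complex S) : Prop :=
  semi_projective P /\
  exists (l : int) (a : int -> nat),
    (exists i, l <= i /\ a i <> 0%N) /\
    forall n : int,
      isomorphic (homology P n)
        (dsum (fun i : {i : int | l <= i} =>
           homology (shift (val i) (power M (a (val i)))) n)).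

(* The infimum of the empty set is +oo. *)
Definition qpd (M : complex S) : \bar int :=
  if `[< exact M >] then -oo%E
  else infimum +oo%E [set q | exists P : complex S,
         [/\ bounded_above P, quasi_projective_resolution P M
           & q = csup P - hsup P]%E]%classic.

End QuasiProjective.

Section Ext.
Variable S : comNzRingType.

Definition projective_resolution (P : complex S) (M : lmodType S)
    (e : chain_map P (mod_complex M)) : Prop :=
  [/\ forall i, projective (P i), forall i, i < 0 -> zero_mod (P i) & quasi_iso e].

(* The module Ext^n(M, N) computed from a projective resolution P of M. *)
Definition Ext_of (P : complex S) (n : nat) (N : lmodType S) : lmodType S :=
  homology (hom_complex P (mod_complex N)) (- n%:Z).

(* Projective resolutions exist and Ext does not depend on their choice. *)
Definition Ext_eq0 (n : nat) (M N : lmodType S) : Prop :=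
  forall (P : complex S) (e : chain_map P (mod_complex M)),
    projective_resolution e -> zero_mod (Ext_of P n N).

End Ext.

Section Rings.
Variable R : comNzRingType.

(* Ideals of R are the submodules of the regular module R^o. *)
Definition noetherian : Prop := forall I : submodClosed R^o, fin_gen (submod I).

Definition maximal_ideal (m : submodClosed R^o) : Prop :=
  1 \notin m /\
  forall J : submodClosed R^o, {subset m <= J} -> 1 \notin J -> {subset J <= m}.

Definition local_ring : Prop :=
  exists m : submodClosed R^o, maximal_ideal m /\
    forall m' : submodClosed R^o, maximal_ideal m' -> m' =i m.

Definition gen_ideal (x : seq R) : {pred R} := fun r =>
  `[< exists c : 'I_(size x) -> R, r = \sum_i c i * x`_i >].

(* Being a nonzerodivisor on R/(x_1, ..., x_(i-1)) is written out in R. *)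
Definition regular_seq (x : seq R) : Prop :=
  (forall i, (i < size x)%N -> forall r,
     r * x`_i \in gen_ideal (take i x) -> r \in gen_ideal (take i x)) /\
  1 \notin gen_ideal x.

Section RegularQuotient.
Variables (x : seq R) (xreg : regular_seq x).

(* [xreg] is kept as a parameter: the idealr instance needs 1 \notin (x). *)
Definition regular_ideal : {pred R} := let _ := xreg in gen_ideal x.

Fact regular_ideal_closed : idealr_closed regular_ideal.
Proof.
split=> [||a u v /asboolP [c ->] /asboolP [d ->]]; last 1 first.
- apply/asboolP; exists (fun i => a * c i + d i).
  rewrite mulr_sumr -big_split; apply: eq_bigr => i _ /=.
  by rewrite mulrDl mulrA.
- by apply/asboolP; exists (fun=> 0); rewrite big1 // => i _; rewrite mul0r.
- exact: xreg.2.
Qed.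

HB.instance Definition _ := isIdealr.Build R regular_ideal regular_ideal_closed.

Definition regular_quotient : comNzRingType := {ideal_quot regular_ideal}.

Definition regular_quotient_pi : {rmorphism R -> regular_quotient} :=
  \pi_{ideal_quot regular_ideal}%qT.

End RegularQuotient.
End Rings.

(* Main.v *)
From HB Require Import structures.
From mathcomp Require Import all_boot all_order all_algebra.
From mathcomp Require Import generic_quotient ring_quotient.
From mathcomp Require Import boolp classical_sets.
From mathcomp Require Import constructive_ereal.
From mathcomp Require Import freeg.
Require Import Defs.
Set Implicit Arguments.
Unset Strict Implicit.
Unset Printing Implicit Defensive.

Import Order.TTheory GRing.Theory Num.Theory.
Local Open Scope ring_scope.

(** Write [A = R/(x)]. A resolution enters the question only through three
    properties: it is semi-projective, it is bounded above, and its homology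
    consists of finite powers of [M], zero in low degrees and somewhere nonzero
    ([qpd_finiteP]). Finiteness of the dimension is the existence of such a
    complex, so complexes have to be carried from [R] to [A] and back.

    From [R] to [A]: given [P] over [R], the complex [P/xP] over [A] is
    semi-projective because homomorphisms from [P/xP] to a complex over [A] are
    homomorphisms from [P] over [R] ([descend_semi_projective]). To compute its
    homology, kill the [x_i] one after the other. The components of [P] are
    projective, so [x_i] is regular on [W = P/(x_1, ..., x_(i-1))P], and it kills
    the homology of [W]; hence each homology module of [W/x_i W] is an extension
    of a power of [M] by a power of [M], and [Ext^1(M, M) = 0] over [R] makes it
    split ([homology_mod_regular]).

    From [A] to [R]: let [P] be semi-projective over [A] with homology zero
    below degree [l]. Its truncation, with the cycles in degree [l], is a bounded
    complex of projective modules ([truncate_semi_projective]). Over [R] these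
    have projective dimension at most [d]; instead of resolving them at once,
    say that an [R]-module is projective relative to [s] if [s] kills it and it
    has the lifting property for modules killed by [s]. Cover a complex [T] of
    modules projective relative to [x_1, ..., x_i] by a contractible complex of
    modules projective relative to [x_1, ..., x_(i-1)]. The kernel [K] of the
    cover again consists of modules projective relative to the shorter sequence
    ([relproj_kernel]), and the homology of [K] is that of [T] up to a shift
    ([relproj_step]), which does no harm since only powers of [M] matter. After
    [d] steps the modules are projective over [R], and a bounded complex of
    projectives is semi-projective ([bounded_semi_projective]).

    Most constructions are stated as existence of a module with linear maps of
    prescribed kernel and image, so that submodules and quotients are used only
    through their universal properties ([factor_surj], [factor_inj]). *)

(** * Linear maps, submodules and quotients *)

Section Linear.
Variable S : comNzRingType.
Implicit Types U V W E Q : lmodType S.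

Lemma linear_ex U V (f : U -> V) : linear f -> exists g : {linear U -> V}, g =1 f.
Proof.
move=> lf; pose F := GRing.isLinear.Build S U V *:%R f lf.
by exists (HB.pack f F : {linear U -> V}).
Qed.

Lemma bij_of_inj_surj (A B : Type) (f : A -> B) :
  injective f -> surj f -> bijective f.
Proof.
move=> fi /choice[g gK]; exists g => // a; exact/fi/gK.
Qed.

Lemma linear_inj U V (f : {linear U -> V}) :
  (forall u, f u = 0 -> u = 0) -> injective f.
Proof.
by move=> f0 u v uv; apply/subr0_eq/f0; rewrite linearB uv subrr.
Qed.

Lemma isomorphic_bij U V (f : {linear U -> V}) :
  (forall u, f u = 0 -> u = 0) -> surj f -> isomorphic U V.
Proof. by move=> /linear_inj fi fs; exists f; exact: bij_of_inj_surj. Qed.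

Lemma factor_surj U E V (p : {linear U -> E}) (f : {linear U -> V}) :
  surj p -> (forall u, p u = 0 -> f u = 0) ->
  exists g : {linear E -> V}, forall u, g (p u) = f u.
Proof.
move=> /choice[s sK] pf.
have eqf u v : p u = p v -> f u = f v.
  by move=> uv; apply/subr0_eq; rewrite -linearB pf // linearB uv subrr.
have lg : linear (fun e => f (s e)).
  by move=> a u v; rewrite -linearP; apply: eqf; rewrite linearP !sK.
by have [g gE] := linear_ex lg; exists g => u; rewrite gE; apply: eqf.
Qed.

Lemma factor_inj U V W (i : {linear U -> V}) (f : {linear W -> V}) :
  (forall u, i u = 0 -> u = 0) -> (forall w, exists u, i u = f w) ->
  exists g : {linear W -> U}, forall w, i (g w) = f w.
Proof.
move=> /linear_inj ii /choice[s sK].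
have lg : linear s by move=> a u v; apply: ii; rewrite linearP !sK linearP.
by have [g gE] := linear_ex lg; exists g => w; rewrite gE.
Qed.

Definition closed_prop V (P : V -> Prop) :=
  P 0 /\ forall a u v, P u -> P v -> P (a *: u + v).

Lemma submodClosed_ex V (P : V -> Prop) : closed_prop P ->
  exists N : submodClosed V, forall v, v \in N <-> P v.
Proof.
move=> [P0 PP]; pose p : {pred V} := fun v => `[< P v >].
have pc : submod_closed p.
  split=> [|a u v /asboolP Pu /asboolP Pv]; apply/asboolP => //; exact: PP.
pose F := GRing.isSubmodClosed.Build S V p pc.
exists (HB.pack p F : submodClosed V) => v; split=> [/asboolP|Pv] //.
exact/asboolP.
Qed.

Lemma sub_ex V (P : V -> Prop) : closed_prop P ->
  exists (K : lmodType S) (i : {linear K -> V}),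
    (forall k, i k = 0 -> k = 0) /\ (forall v, P v <-> exists k, i k = v).
Proof.
move=> /submodClosed_ex[N NP]; exists (submod N).
have lv : linear (@submod_val S V N) by [].
have [i iE] := linear_ex lv; exists i; split=> [k|v].
  by rewrite iE => k0; apply: val_inj; rewrite /= k0.
split=> [/NP Nv|[k <-]]; first by exists (Submod Nv); rewrite iE.
by apply/NP; rewrite iE; exact: submod_valP.
Qed.

Lemma quot_ex V (P : V -> Prop) : closed_prop P ->
  exists (Q : lmodType S) (q : {linear V -> Q}),
    surj q /\ (forall v, q v = 0 <-> P v).
Proof.
move=> /submodClosed_ex[N NP]; exists (quotmod N), (@quotmod_pi S V N).
split=> [e|v]; first by exists (quotmod_repr e); exact: quotmod_reprK.
by rewrite -(linear0 (@quotmod_pi S V N)) quotmod_piP subr0; exact: NP.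
Qed.

End Linear.

(** * Cycles, boundaries and homology *)

Section Homology.
Variable S : comNzRingType.
Implicit Types X Y : complex S.

(** Allowing every second index in the differential spares transports along
    equalities such as [n + 1 - 1 = n]; only one of the maps is nonzero. *)
Definition cyc X n (z : X n) := forall j, diff X n j z = 0.
Definition bnd X n (z : X n) := exists i y, diff X i n y = z.

Lemma cycP X n j (z : X n) : n = j + 1 -> cyc z <-> diff X n j z = 0.
Proof.
move=> nj; split=> [|z0 k]; first exact.
have [kj|kj] := eqVneq n (k + 1); last by rewrite diff_shape.
by have <- : j = k by apply/(addIr 1); rewrite -nj.
Qed.

Lemma bndP X n i (z : X n) : i = n + 1 -> bnd z <-> exists y, diff X i n y = z.
Proof.
move=> ni; split=> [[j [y]]|[y yz]]; last by exists i, y.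
have [jn|jn] := eqVneq j (n + 1); last first.
  by rewrite diff_shape // => <-; exists 0; rewrite linear0.
by move: y; rewrite jn ni => y <-; exists y.
Qed.

Lemma cyc0 X n : cyc (0 : X n). Proof. by move=> j; rewrite linear0. Qed.
Lemma bnd0 X n : bnd (0 : X n). Proof. by exists n, 0; rewrite linear0. Qed.

Lemma cycL X n a (y z : X n) : cyc y -> cyc z -> cyc (a *: y + z).
Proof. by move=> cy cz j; rewrite linearP cy cz scaler0 addr0. Qed.

Lemma bndL X n a (y z : X n) : bnd y -> bnd z -> bnd (a *: y + z).
Proof.
move=> /(bndP _ erefl)[u <-] /(bndP _ erefl)[v <-].
by apply/(bndP _ erefl); exists (a *: u + v); rewrite linearP.
Qed.

Lemma cycB X n (y z : X n) : cyc y -> cyc z -> cyc (y - z).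
Proof. by move=> cy cz; rewrite -scaleN1r addrC; apply: cycL. Qed.

Lemma cyc_bnd X n (z : X n) : bnd z -> cyc z.
Proof. by move=> [i [y <-]] j; exact: diff_diff. Qed.

Lemma cyc_map X Y (f : chain_map X Y) n (z : X n) : cyc z -> cyc (f n z).
Proof. by move=> cz j; rewrite -cmap_diff cz linear0. Qed.

Lemma bnd_map X Y (f : chain_map X Y) n (z : X n) : bnd z -> bnd (f n z).
Proof. by move=> [i [y <-]]; exists i, (f i y); rewrite cmap_diff. Qed.

Lemma submod_cyc X n (z : cycles X n) : cyc (submod_val z).
Proof.
by apply/(@cycP X n (n - 1)); rewrite ?subrK //; exact/eqP/(submod_valP z).
Qed.

Lemma cyc_submod X n (z : X n) : cyc z -> exists c : cycles X n, submod_val c = z.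
Proof.
move=> cz; suff h : z \in @cycle_pred S X n by exists (Submod h).
exact/eqP/cz.
Qed.

Definition cls X n : {linear cycles X n -> homology X n} :=
  @quotmod_pi S (cycles X n) (@boundary_pred S X n).

Lemma cls_surj X n : surj (cls X n).
Proof. by move=> e; exists (quotmod_repr e); exact: quotmod_reprK. Qed.

Lemma cls_eq0 X n (z : cycles X n) : cls X n z = 0 <-> bnd (submod_val z).
Proof.
rewrite -(linear0 (cls X n)) quotmod_piP subr0 (@bndP X n (n + 1)) //.
by split=> [/asboolP|h] //; apply/asboolP.
Qed.

(** Read on cycles and boundaries, a quasi-isomorphism does not mention the
    homology modules, and is visibly stable under restriction of scalars. *)
Lemma quasi_isoP X Y (b : chain_map X Y) :
  quasi_iso b <-> forall n,
    (forall y : Y n, cyc y -> exists x, cyc x /\ bnd (b n x - y)) /\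
    (forall x : X n, cyc x -> bnd (b n x) -> bnd x).
Proof.
have mapE n (z : cycles X n) :
    homology_map b (cls X n z) = cls Y n (cycle_map b z).
  exact: homology_map_pi.
have clsB (Z : complex S) n (y z : cycles Z n) :
    cls Z n y = cls Z n z <-> bnd (submod_val y - submod_val z).
  rewrite -[_ - _]/(submod_val (y - z)) -cls_eq0 linearB.
  by split=> [->|/subr0_eq]; rewrite ?subrr.
split=> [qb n|H n].
  have [g gK Kg] := qb n; split=> [y /cyc_submod[c <-]|x /cyc_submod[c <-] bx].
    have [d dE] := cls_surj (g (cls Y n c)).
    exists (submod_val d); split; first exact: submod_cyc.
    by apply/(clsB Y n (cycle_map b d) c); rewrite -mapE dE Kg.
  apply/cls_eq0/(can_inj gK); rewrite mapE -(linear0 (cls X n)) mapE.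
  by apply/clsB; rewrite /= linear0 subr0.
apply: bij_of_inj_surj => [u v|y].
  have [[c <-] [d <-]] := (cls_surj u, cls_surj v).
  rewrite !mapE => /clsB h; apply/clsB/(H n).2; first by apply: cycB; exact: submod_cyc.
  by rewrite linearB.
have [c <-] := cls_surj y; have [x [cx bx]] := (H n).1 _ (submod_cyc c).
have [d dx] := cyc_submod cx; exists (cls X n d); rewrite mapE; apply/clsB.
by rewrite /= dx.
Qed.

(** The map [h] is defined on all of [X n] but is meaningful on cycles only;
    this makes the notion independent of the ring through which scalars act,
    so that the same [h] serves before and after restriction of scalars. *)
Definition homology_model X n (V : lmodType S) := exists h : X n -> V,
  [/\ forall a y z, cyc y -> cyc z -> h (a *: y + z) = a *: h y + h z,
      forall z, cyc z -> (h z = 0 <-> bnd z) &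
      forall v, exists2 z, cyc z & h z = v].

Lemma homology_modelP X n V :
  isomorphic (homology X n) V <-> homology_model X n V.
Proof.
split=> [[f fb]|[h [hl h0 hs]]].
  have [h hE] : exists h : X n -> V, forall c, h (submod_val c) = f (cls X n c).
    have : forall x : X n, exists v, forall c : cycles X n,
        submod_val c = x -> v = f (cls X n c).
      move=> x; have [/cyc_submod[c cx]|nx] := pselect (cyc x).
        by exists (f (cls X n c)) => d dx; do 2 f_equal; apply: val_inj; rewrite /= cx.
      by exists 0 => c cx; case: nx; rewrite -cx; exact: submod_cyc.
    by move=> /choice[h hE]; exists h => c; apply: hE.
  exists h; split=> [a y z /cyc_submod[c <-] /cyc_submod[d <-]|z|v].
  - have -> : a *: submod_val c + submod_val d = submod_val (a *: c + d) by [].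
    by rewrite !hE !linearP.
  - move=> /cyc_submod[c <-]; rewrite hE -cls_eq0.
    by split=> [e|->]; rewrite ?linear0 //; apply: (bij_inj fb); rewrite linear0.
  - have [g gK Kg] := fb; have [c cE] := cls_surj (g v).
    by exists (submod_val c); [exact: submod_cyc | rewrite hE cE Kg].
have lg : linear (fun c : cycles X n => h (submod_val c)).
  by move=> a c d; rewrite hl //; exact: submod_cyc.
have [g gE] := linear_ex lg.
have [|f fE] := factor_surj (@cls_surj X n) (f := g).
  by move=> u /cls_eq0 bu; rewrite gE; apply/h0 => //; exact: submod_cyc.
apply: (@isomorphic_bij _ _ _ f) => [u|v].
  have [c <-] := cls_surj u; rewrite fE gE => hc.
  by apply/cls_eq0/h0 => //; exact: submod_cyc.
have [z /cyc_submod[c <-] hz] := hs v.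
by exists (cls X n c); rewrite fE gE.
Qed.

Lemma zero_homologyP X n :
  zero_mod (homology X n) <-> forall z : X n, cyc z -> bnd z.
Proof.
split=> [h0 z /cyc_submod[c <-]|H h]; first exact/cls_eq0.
by have [c <-] := cls_surj h; apply/cls_eq0/H; exact: submod_cyc.
Qed.

End Homology.

(** * Finite quasi-projective dimension *)

Section Powers.
Variable S : comNzRingType.
Implicit Types (X : complex S) (M U V W : lmodType S).

Lemma isomorphic_trans U V W : isomorphic U V -> isomorphic V W -> isomorphic U W.
Proof. by move=> [f fb] [g gb]; exists (g \o f); exact: bij_comp. Qed.

Lemma isomorphic_sym U V : isomorphic U V -> isomorphic V U.
Proof.
move=> [f [g fK gK]]; have lg : linear g.
  by move=> a u v; apply: (can_inj fK); rewrite linearP !gK.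
have [h hE] := linear_ex lg; exists h; exists f => x; rewrite hE; first exact: gK.
exact: fK.
Qed.

Lemma isomorphic_zero U V : zero_mod U -> zero_mod V -> isomorphic U V.
Proof.
move=> U0 V0; apply: (@isomorphic_bij _ _ _ (\0 : {linear U -> V})) => [u _|v].
  exact: U0.
by exists 0; rewrite (V0 v).
Qed.

Lemma zero_mod_iso U V : isomorphic U V -> zero_mod U -> zero_mod V.
Proof. by move=> [f [g fK gK]] U0 v; rewrite -(gK v) (U0 (g v)) linear0. Qed.

Lemma zero_ffun0 M : zero_mod {ffun 'I_0 -> M}.
Proof. by move=> f; apply/ffunP => -[]. Qed.

Lemma zero_pow M a : ~ zero_mod M -> (zero_mod {ffun 'I_a -> M} <-> a = 0%N).
Proof.
move=> Mnz; split=> [|->]; last exact: zero_ffun0.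
case: a => [//|a] H; case: Mnz => m.
by have /ffunP/(_ ord0) := H [ffun=> m]; rewrite !ffunE.
Qed.

Lemma mod_obj_zero M j : j != 0 -> zero_mod (mod_obj M j).
Proof. by move=> j0; rewrite /mod_obj (negPf j0) => v; exact: thinmx0. Qed.

Lemma homology_shift_zero M i n a : n != i ->
  zero_mod (homology (shift i (power (mod_complex M) a)) n).
Proof.
move=> ni; apply/zero_homologyP => z _; suff -> : z = 0 by exact: bnd0.
by apply/ffunP => t; rewrite (@mod_obj_zero M _ _ (z t)) ?ffunE // subr_eq0.
Qed.

Lemma homology_shift M n a :
  isomorphic (homology (shift n (power (mod_complex M) a)) n) {ffun 'I_a -> M}.
Proof.
set X := shift _ _; have d0 i j (z : X i) : diff X i j z = 0.
  by apply/ffunP => t; rewrite !ffunE scaler0.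
apply: (@isomorphic_trans _ (X n)).
  apply/homology_modelP; exists id; split=> // [z _|v].
    by split=> [->|[i [y <-]]]; [exact: bnd0 | rewrite d0].
  by exists v => // j; rewrite d0.
rewrite /= ; move: (n - n) (subrr n) => j ->.
by exists (idfun : {linear {ffun 'I_a -> M} -> {ffun 'I_a -> M}}); exists id.
Qed.

(** The complex [M^(a i)] shifted by [i] has homology in degree [i] only, so in
    degree [n] the direct sum keeps one summand, present when [l <= n]. *)
Lemma homology_dsum M (l : int) (a : int -> nat) n :
  isomorphic (dsum (fun i : {i : int | l <= i} =>
                homology (shift (val i) (power (mod_complex M) (a (val i)))) n))
    {ffun 'I_(if l <= n then a n else 0) -> M}.
Proof.
set V := fun i : {i | l <= i} => homology _ n.
have V0 i : val i != n -> zero_mod (V i).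
  by move=> ni; apply: homology_shift_zero; rewrite eq_sym.
have ext (f g : dsum V) : (forall i, submod_val f i = submod_val g i) -> f = g.
  by move=> fg; apply: val_inj; apply: functional_extensionality_dep.
case: ifP => [ln|/negbT ln]; last first.
  apply: isomorphic_zero; last exact: zero_ffun0.
  move=> f; apply: ext => i; apply: V0.
  by apply: contra ln => /eqP <-; exact: (valP i).
pose i0 : {i | l <= i} := exist _ n ln.
apply: (isomorphic_trans _ (homology_shift M n (a n))).
have le : linear (fun f : dsum V => submod_val f i0) by [].
have [e eE] := linear_ex le.
apply: (@isomorphic_bij _ _ _ e) => [f|v].
  rewrite eE => f0; apply: ext => i.
  have [ii|ii] := eqVneq (val i) n; last by rewrite (V0 i ii (submod_val f i)).
  by have -> : i = i0 by exact: val_inj.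
pose g : dprod V := dfwith (fun i => 0 : V i) (v : V i0).
suff gs : g \in @finsupp_pred S _ V.
  by exists (Submod gs); rewrite eE /= /g dfwith_in.
apply/asboolP/(cardinality.sub_finite_set _ (cardinality.finite_set1 i0)) => i /=.
by apply: contra_neqP => /eqP ii; rewrite /g dfwith_out // eq_sym.
Qed.

Definition homology_powers X M (a : int -> nat) :=
  forall n, homology_model X n {ffun 'I_(a n) -> M}.

Definition finite_support_below (a : int -> nat) :=
  (exists l, forall n, n < l -> a n = 0%N) /\ (exists n, a n <> 0%N).

Lemma quasi_projective_resolutionP X M :
  quasi_projective_resolution X (mod_complex M) <->
  semi_projective X /\ exists2 a, finite_support_below a & homology_powers X M a.
Proof.
split=> -[sp H]; split=> //.
  have [l [a [[i [li ai]] H']]] := H.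
  exists (fun n => if l <= n then a n else 0%N).
    split; first by exists l => n; rewrite ltNge => /negPf->.
    by exists i; rewrite li.
  move=> n; apply/homology_modelP.
  exact: isomorphic_trans (H' n) (homology_dsum M l a n).
have [a [[l al] [i ai]] Ha] := H; exists l, a; split.
  by exists i; split=> //; rewrite leNgt; apply/negP => /al.
move=> n; have /homology_modelP h := Ha n; apply: (isomorphic_trans h).
apply: isomorphic_sym; have := homology_dsum M l a n.
by rewrite leNgt; case: ltP => [/al->|].
Qed.

Lemma exact_mod_complex M : exact (mod_complex M) <-> zero_mod M.
Proof.
split=> [/(_ 0)/zero_homologyP H m|M0 n].
  by have [|i [y <-]] := H (m : mod_complex M 0).
apply/zero_homologyP => z _; suff -> : z = 0 by exact: bnd0.
have [n0|n0] := eqVneq n 0; last exact: mod_obj_zero.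
by move: z; rewrite n0 => z; exact: M0.
Qed.

End Powers.

Section Orders.
Implicit Types (A : set (\bar int)).

(** [infimum] is a default value unless a greatest lower bound is exhibited;
    well-ordering of the naturals provides one, namely a least element. *)
Lemma infimum_lt_pinfty A q :
  (forall r, A r -> (0 <= r)%E) -> A q -> (q < +oo)%E -> (infimum +oo%E A < +oo)%E.
Proof.
move=> A0 Aq qoo; suff [m [Am mle]] : exists m, infimums A m.
  rewrite /infimum; case: ifP => [/eqP A00|_]; first by move: Aq; rewrite A00.
  case: xgetP => [r _ [rl _]|/(_ m)[]//]; exact: le_lt_trans (rl _ Aq) qoo.
have Aq' : exists n : nat, `[< A n%:Z%:E >].
  have := A0 _ Aq; case: q qoo Aq => // -[n|n] _ Aq //= _.
  by exists n; exact/asboolP.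
have /asboolP Am := ex_minnP Aq'; case: (ex_minnP Aq') => m /asboolP {}Am mmin.
exists m%:Z%:E; split=> [r Ar|r]; last exact.
have := A0 _ Ar; case: r Ar => [[n|n]| |] Ar r0; last 1 first.
- by move: r0; rewrite leeNy_eq.
- by rewrite lee_fin lez_nat; apply: mmin; exact/asboolP.
- by [].
- exact: leey.
Qed.

Lemma supremum_int (B : set int) b i :
  (forall j, B j -> j <= b) -> B i ->
  exists j, [/\ B j, forall k, B k -> k <= j &
    supremum -oo%E [set k%:E | k in B]%classic = j%:E].
Proof.
move=> Bb Bi; have [m mB] : exists m : nat, b = i + m%:Z.
  have := Bb _ Bi; rewrite -subr_ge0; case E: (b - i) => [m|//] _.
  by exists m; rewrite -E addrC subrK.
have ex : exists n : nat, `[< B (b - n%:Z) >].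
  by exists m; apply/asboolP; rewrite mB addrK.
case: (ex_minnP ex) => n /asboolP Bn nmin; exists (b - n%:Z).
have ub k : B k -> k <= b - n%:Z.
  move=> Bk.
  have := Bb _ Bk; rewrite -subr_ge0; case E: (b - k) => [p|//] _.
  have kE : k = b - p%:Z by rewrite -E opprB addrC subrK.
  have /nmin np : `[< B (b - p%:Z) >] by apply/asboolP; rewrite -kE.
  by rewrite kE lerD2l lerN2 lez_nat.
have su : supremums [set k%:E | k in B]%classic (b - n%:Z)%:E.
  split=> [_ [k /ub kb <-]|r]; first by rewrite lee_fin.
  by apply; exists (b - n%:Z).
split=> //.
rewrite /supremum; case: ifP => [/eqP E|_].
  by have : set0 (i%:E : \bar int) by rewrite -E; exists i.
by case: xgetP => [r _ sr|/(_ _ su)//]; exact: is_subset1_supremums sr su.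
Qed.

End Orders.

Section QpdFinite.
Variable S : comNzRingType.
Implicit Types (X : complex S) (M : lmodType S).

Lemma csup_ge_hsup X : bounded_above X -> ~ exact X ->
  exists2 q, (csup X - hsup X)%E = q%:E & 0 <= q.
Proof.
move=> [b Xb] /existsNP[n Hn].
have HX i : ~ zero_mod (homology X i) -> ~ zero_mod (X i).
  move=> Hi Xi; apply/Hi/zero_homologyP => z _; rewrite (Xi z); exact: bnd0.
have Xi i : ~ zero_mod (X i) -> i <= b.
  by move=> Xi; rewrite leNgt; apply/negP => /Xb.
have [j [Xj jmax sj]] := @supremum_int [set i | ~ zero_mod (X i)] b n Xi (HX _ Hn).
have [k [Hk _ sk]] := @supremum_int [set i | ~ zero_mod (homology X i)] b n
  (fun i => @Xi i \o @HX i) Hn.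
exists (j - k); first by rewrite /csup sj /hsup sk.
by rewrite subr_ge0; exact/jmax/HX.
Qed.

(** As [M] is nonzero, a bounded above resolution has nonzero homology; both
    suprema are then integers, with a nonnegative difference, so one resolution
    suffices for the infimum to be finite. *)
Lemma qpd_finiteP M : ~ zero_mod M ->
  (qpd (mod_complex M) < +oo)%E <->
  exists X, [/\ bounded_above X, semi_projective X &
    exists2 a, finite_support_below a & homology_powers X M a].
Proof.
move=> Mnz; rewrite /qpd asboolF; last by move=> /exact_mod_complex.
split=> [|[X [Xb sp Ha]]].
  set A := (X in infimum _ X) => h.
  have /set0P[q [X [Xb /quasi_projective_resolutionP[sp Ha] _]]] : A != set0.
    by apply/eqP => A0; move: h; rewrite A0 /infimum eqxx.
  by exists X.
have fin Y : bounded_above Y -> quasi_projective_resolution Y (mod_complex M) ->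
    exists2 q, (csup Y - hsup Y)%E = q%:E & 0 <= q.
  move=> Yb /quasi_projective_resolutionP[_ [a [_ [n an]] H]].
  apply: csup_ge_hsup => // /(_ n) Y0.
  by have /homology_modelP/zero_mod_iso/(_ Y0)/(zero_pow _ Mnz) := H n.
have qX : quasi_projective_resolution X (mod_complex M).
  exact/quasi_projective_resolutionP.
have [q qE q0] := fin _ Xb qX.
apply: (@infimum_lt_pinfty _ q%:E); last exact: ltry.
  by move=> r [Y [Yb qY ->]]; have [p -> p0] := fin _ Yb qY; rewrite lee_fin.
by exists X.
Qed.

End QpdFinite.

(** * Building complexes *)

Section BuildComplexes.
Variable S : comNzRingType.
Implicit Types (X Y : complex S).

Lemma subcomplex_ex X (P : forall n, X n -> Prop) :
  (forall n, closed_prop (P n)) -> (forall i j x, P i x -> P j (diff X i j x)) ->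
  exists (K : complex S) (k : chain_map K X),
    (forall n x, k n x = 0 -> x = 0) /\ (forall n x, P n x <-> exists y, k n y = x).
Proof.
move=> Pc Pd; pose K n := projT1 (cid (sub_ex (Pc n))).
pose k n : {linear K n -> X n} := projT1 (cid (projT2 (cid (sub_ex (Pc n))))).
have [k0 kP] : (forall n x, k n x = 0 -> x = 0) /\
    (forall n x, P n x <-> exists y, k n y = x).
  by split=> n; have [] := projT2 (cid (projT2 (cid (sub_ex (Pc n))))).
have dx i j : exists d : {linear K i -> K j}, forall x, k j (d x) = diff X i j (k i x).
  apply: (@factor_inj _ _ _ _ (k j) (diff X i j \o k i)) => [|x /=]; first exact: k0.
  by apply/kP/Pd/kP; exists x.
pose d i j := projT1 (cid (dx i j)).
have dE i j x : k j (d i j x) = diff X i j (k i x) by exact: (projT2 (cid (dx i j))).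
have ds i j : i != j + 1 -> forall x, d i j x = 0.
  by move=> ij x; apply: k0; rewrite dE diff_shape.
have dd i j l x : d j l (d i j x) = 0.
  by apply: k0; rewrite !dE diff_diff.
by exists (Complex ds dd), (@ChainMap _ (Complex ds dd) X k dE).
Qed.

Lemma quotient_complex_ex X (P : forall n, X n -> Prop) :
  (forall n, closed_prop (P n)) -> (forall i j x, P i x -> P j (diff X i j x)) ->
  exists (Q : complex S) (q : chain_map X Q),
    cmap_surj q /\ (forall n x, q n x = 0 <-> P n x).
Proof.
move=> Pc Pd; pose Q n := projT1 (cid (quot_ex (Pc n))).
pose q n : {linear X n -> Q n} := projT1 (cid (projT2 (cid (quot_ex (Pc n))))).
have [qs qP] : (forall n, surj (q n)) /\ (forall n x, q n x = 0 <-> P n x).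
  by split=> n; have [] := projT2 (cid (projT2 (cid (quot_ex (Pc n))))).
have dx i j : exists d : {linear Q i -> Q j}, forall x, d (q i x) = q j (diff X i j x).
  apply: (@factor_surj _ _ _ _ (q i) (q j \o diff X i j)) => [|x /= /qP Px].
    exact: qs.
  exact/qP/Pd.
pose d i j := projT1 (cid (dx i j)).
have dE i j x : d i j (q i x) = q j (diff X i j x) by exact: (projT2 (cid (dx i j))).
have ds i j : i != j + 1 -> forall x, d i j x = 0.
  by move=> ij x; have [y <-] := qs i x; rewrite dE diff_shape ?linear0.
have dd i j l x : d j l (d i j x) = 0.
  by have [y <-] := qs i x; rewrite !dE diff_diff linear0.
exists (Complex ds dd).
by exists (@ChainMap _ X (Complex ds dd) q (fun i j x => esym (dE i j x))).
Qed.

Section At.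
Variables (I : eqType) (V : I -> lmodType S).

(** Serves to move an element between degrees whose equality is only provable:
    no transport is visible, and off the degree [i] the result is zero. *)
Definition at_ (i : I) (v : V i) (j : I) : V j := dfwith (fun k => 0 : V k) v j.

Lemma at_in i v : @at_ i v i = v. Proof. exact: dfwith_in. Qed.
Lemma at_out i v j : i != j -> @at_ i v j = 0. Proof. exact: dfwith_out. Qed.

Lemma at_linear i j : linear (fun v => @at_ i v j).
Proof.
move=> a u v; have [<-|ij] := eqVneq i j; first by rewrite !at_in.
by rewrite !at_out // scaler0 addr0.
Qed.

Lemma at_0 i j : @at_ i 0 j = 0.
Proof. by have := @at_linear i j (-1) 0 0; rewrite !scaleN1r !addNr. Qed.

End At.

Section Disc.
Variable U : int -> lmodType S.

Definition disc_obj n : lmodType S := (U n * U (n + 1))%type.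

Lemma disc_ex : exists d : forall i j, {linear disc_obj i -> disc_obj j},
  forall i j x, d i j x = (0, at_ (V := U) x.1 (j + 1)).
Proof.
have dx i j : exists d : {linear disc_obj i -> disc_obj j},
    forall x, d x = (0, at_ (V := U) x.1 (j + 1)).
  apply: linear_ex => a x y /=.
  by apply: injective_projections => /=; rewrite ?scaler0 ?addr0 ?at_linear.
by exists (fun i j => projT1 (cid (dx i j))) => i j x; exact: (projT2 (cid (dx i j)) x).
Qed.

Definition disc_diff := projT1 (cid disc_ex).
Lemma disc_diffE i j x : disc_diff i j x = (0, at_ (V := U) x.1 (j + 1)).
Proof. exact: (projT2 (cid disc_ex)). Qed.

Fact disc_shape i j : i != j + 1 -> forall x, disc_diff i j x = 0.
Proof. by move=> ij x; rewrite disc_diffE at_out. Qed.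

Fact disc_diff_diff i j k x : disc_diff j k (disc_diff i j x) = 0.
Proof.
rewrite !disc_diffE /= ; have [->|jk] := eqVneq j (k + 1); last by rewrite at_out.
by rewrite at_in.
Qed.

(** The direct sum over [n] of the contractible complexes with identity
    differential from [U n] in degree [n] to [U n] in degree [n - 1]. *)
Definition disc : complex S := Complex disc_shape disc_diff_diff.

Lemma disc_exact n (z : disc n) : cyc z -> bnd z.
Proof.
move=> /(_ (n - 1)) /=; rewrite disc_diffE => -[].
have : n = n - 1 + 1 by rewrite subrK.
move: (n - 1 + 1) => m nm; move: z; rewrite nm => z; rewrite at_in => z0.
by exists (m + 1), (z.2, 0); rewrite /= disc_diffE at_in -z0; case: z {z0}.
Qed.

End Disc.

End BuildComplexes.

(** * Semi-projective complexes *)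

Section HomFamilies.
Variables (S : comNzRingType).
Implicit Types (P X Y : complex S).

Definition is_hom P X n (f : forall i j, P i -> X j) :=
  (forall i j, linear (f i j)) /\ (forall i j, j != i + n -> forall x, f i j x = 0).

Lemma is_homP P X n (f : hom_complex P X n) : is_hom n (submod_val f).
Proof. exact/asboolP/(submod_valP f). Qed.

Lemma is_hom_ex P X n (f : forall i j, P i -> X j) :
  is_hom n f -> exists F : hom_complex P X n, submod_val F = f.
Proof.
move=> hf; suff h : (f : hom_family P X) \in @hom_pred S P X n by exists (Submod h).
exact/asboolP.
Qed.

Lemma hom_ext P X n (f g : hom_complex P X n) :
  (forall i j x, submod_val f i j x = submod_val g i j x) -> f = g.
Proof.
move=> fg; apply: val_inj; do 3!apply: functional_extensionality_dep => ?.
exact: fg.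
Qed.

Lemma hom_map0 P X Y (b : chain_map X Y) n (f : hom_complex P X n) :
  hom_map P b n f = 0 <-> forall i j x, b j (submod_val f i j x) = 0.
Proof.
split=> [e i j x|H]; last exact: hom_ext.
exact: (congr1 (fun g : hom_complex P Y n => submod_val g i j x) e).
Qed.

Lemma hom_diffE P X n m (f : hom_complex P X n) i k x : n = m + 1 ->
  submod_val (diff (hom_complex P X) n m f) i k x =
  diff X (k + 1) k (submod_val f i (k + 1) x)
    - (-1) ^+ `|n|%N *: submod_val f (i - 1) k (diff P i (i - 1) x).
Proof. by move=> nm; subst n; rewrite /= eqxx. Qed.

Lemma at_diff X i k (y : X i) :
  at_ (V := X) (diff X i (i - 1) y) k = diff X (k + 1) k (at_ (V := X) y (k + 1)).
Proof.
have [ik|ik] := eqVneq i (k + 1); last first.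
  rewrite !at_out ?linear0 //; apply: contra ik => /eqP <-.
  by rewrite subrK.
subst i; rewrite at_in; move: (k + 1 - 1) (addrK 1 k) => j ->; exact: at_in.
Qed.

Definition single P X i j (c : P i -> X j) : forall i' j', P i' -> X j' :=
  dfwith (fun i' j' (x : P i') => 0 : X j') (i := i) (fun j' x => at_ (V := X) (c x) j').

#[local] Arguments single {P X i j} c i' j' x : rename.

Lemma single_in P X i j (c : P i -> X j) x : single c i j x = c x.
Proof. by rewrite /single dfwith_in at_in. Qed.

Lemma single_outl P X i j (c : P i -> X j) i' j' x : i != i' -> single c i' j' x = 0.
Proof. by move=> ii; rewrite /single dfwith_out. Qed.

Lemma single_outr P X i j (c : P i -> X j) i' j' x : j != j' -> single c i' j' x = 0.
Proof.
move=> jj; have [ii|ii] := eqVneq i i'; last exact: single_outl.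
by subst i'; rewrite /single dfwith_in at_out.
Qed.

Lemma single_hom P X i j n (c : {linear P i -> X j}) :
  j = i + n -> is_hom n (single c).
Proof.
move=> ji; split=> [i' j' a x y|i' j' ij x].
  have [ii|ii] := eqVneq i i'; last by rewrite !single_outl // scaler0 addr0.
  have [jj|jj] := eqVneq j j'; last by rewrite !single_outr // scaler0 addr0.
  by subst i' j'; rewrite !single_in linearP.
have [ii|ii] := eqVneq i i'; last exact: single_outl.
by apply: single_outr; rewrite ji ii eq_sym.
Qed.

(** The long exact sequence of a surjection: it is a quasi-isomorphism exactly
    when its kernel is exact. *)
Lemma cmap_surj_kernel X Y (b : chain_map X Y) : cmap_surj b ->
  quasi_iso b <-> forall n (x : X n), cyc x -> b n x = 0 ->
     exists y : X (n + 1), b _ y = 0 /\ diff X (n + 1) n y = x.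
Proof.
move=> bs; rewrite quasi_isoP; split=> [H n x cx bx|H n].
  have [|u ux] := (bndP _ (erefl (n + 1))).1 ((H n).2 x cx _).
    by rewrite bx; exact: bnd0.
  have [|z [cz /(bndP _ erefl)[w wz]]] := (H (n + 1)).1 (b _ u).
    by apply/(@cycP _ _ _ n) => //; rewrite -cmap_diff ux.
  have [w' ww] := bs _ w; exists (u - z + diff X _ _ w'); split.
    by rewrite linearD linearB cmap_diff ww wz subrKA subrr.
  by rewrite linearD linearB diff_diff addr0 ux cz subr0.
split=> [y cy|x cx /(bndP _ erefl)[y yx]].
  have [x xy] := bs n y.
  have [||u [bu ux]] := H (n - 1) (diff X n (n - 1) x).
  - exact/cyc_bnd/(ex_intro _ n)/(ex_intro _ x).
  - by rewrite cmap_diff xy cy.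
  move: u bu ux; rewrite subrK => u bu ux.
  exists (x - u); split; last by rewrite linearB bu subr0 xy subrr; exact: bnd0.
  by apply/(@cycP _ _ _ (n - 1)); rewrite ?subrK // linearB ux subrr.
have [u uy] := bs _ y.
have [||w [_ wx]] := H n (x - diff X (n + 1) n u).
- apply: cycB => //; exact/cyc_bnd/(ex_intro _ (n + 1))/(ex_intro _ u).
- by rewrite linearB cmap_diff uy yx subrr.
by exists (n + 1), (w + u); rewrite linearD wx subrK.
Qed.

End HomFamilies.
Arguments single {S P X i j} c i' j' x : rename.

Section SemiProjective.
Variable S : comNzRingType.
Implicit Types (P X Y : complex S).

(** A linear map out of [P i] is a homomorphism from [P] to the contractible
    complex [disc], so lifting homomorphisms lifts linear maps. *)
Lemma semi_projective_obj P i : semi_projective P -> projective (P i).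
Proof.
move=> sp U V b f bs.
have [B0 BE] : exists g : {linear (U * U)%type -> (V * V)%type},
    forall x, g x = (b x.1, b x.2).
  by apply: linear_ex => a x y /=; rewrite !linearP.
pose B n : {linear disc (fun=> U) n -> disc (fun=> V) n} := B0.
have Bd k j x : B j (diff (disc (fun=> U)) k j x) = diff (disc (fun=> V)) k j (B k x).
  rewrite /= !disc_diffE !BE /= linear0; have [->|kj] := eqVneq k (j + 1).
    by rewrite !at_in.
  by rewrite !at_out // linear0.
pose C := ChainMap Bd.
have Cs : cmap_surj C.
  move=> n [v w]; have [u <-] := bs v; have [u' <-] := bs w.
  by exists (u, u'); rewrite /= BE.
have Cq : quasi_iso C.
  apply/quasi_isoP => n; split=> [y cy|x cx _]; last exact: disc_exact.
  exists 0; split; first exact: cyc0.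
  by apply: disc_exact; apply: cycB => //; rewrite linear0; exact: cyc0.
have [g gE] : exists g : {linear P i -> disc (fun=> V) i}, forall x, g x = (f x, 0).
  apply: linear_ex => a x y; rewrite linearP.
  by apply: injective_projections => /=; rewrite ?scaler0 ?addr0.
have [G GE] := is_hom_ex (single_hom g (esym (addr0 i))).
have [H HE] := (sp _ _ C Cs Cq).1 0 G.
have hl : linear (fun x => (submod_val H i i x).1 : U).
  by move=> a x y; rewrite (is_homP H).1.
have [h hE] := linear_ex hl; exists h => x.
have := congr1 (fun F : hom_complex P (disc (fun=> V)) 0 => (submod_val F i i x).1 : V) HE.
by rewrite hE GE single_in gE /= BE.
Qed.

(** If [Y] is exact, [Y -> 0] is a surjective quasi-isomorphism, so the complex
    of homomorphisms from [P] to [Y] is exact; a chain map is one of its cycles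
    of degree [0], and a preimage under the differential is a homotopy. *)
Lemma semi_projective_null P Y (f : chain_map P Y) :
  semi_projective P -> (forall n (z : Y n), cyc z -> bnd z) ->
  exists s : forall i j, {linear P i -> Y j},
    forall i x, f i x = diff Y (i + 1) i (s i (i + 1) x)
                        + s (i - 1) i (diff P i (i - 1) x).
Proof.
move=> sp Yx; pose Z := mod_complex 'rV[S]_0.
have Z0 n (z : Z n) : z = 0.
  by rewrite /= in z *; move: z; rewrite /mod_obj; case: ifP => _ z; exact: thinmx0.
pose b := @ChainMap _ Y Z (fun n => (\0 : {linear Y n -> Z n})) (fun _ _ _ => erefl).
have bs : cmap_surj b by move=> n z; exists 0; rewrite (Z0 _ z).
have bq : quasi_iso b.
  apply/quasi_isoP => n; split=> [y _|x cx _]; last exact: Yx.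
  by exists 0; split; [exact: cyc0 | rewrite (Z0 _ (_ - _)); exact: bnd0].
have fh : @is_hom _ P Y 0 (fun i j x => at_ (V := Y) (f i x) j).
  split=> [i j a x y|i j ij x]; first by rewrite linearP (at_linear _ a (f i x)).
  by rewrite at_out // eq_sym -[X in _ != X]addr0.
have [F FE] := is_hom_ex fh.
have cF : cyc F.
  apply/(@cycP _ (hom_complex P Y) _ (- 1)) => //; apply: hom_ext => i k x.
  rewrite hom_diffE // FE scale1r -[RHS]/(0 : Y k).
  by rewrite cmap_diff at_diff subrr.
have [_ /(_ F cF)] := (quasi_isoP (hom_map P b)).1 (sp _ _ b bs bq).2 0.
have -> : hom_map P b 0 F = 0 by apply/hom_map0 => i j x; exact: Z0.
move=> /(_ (bnd0 _ _))/(@bndP _ (hom_complex P Y) _ 1)[//|s sF].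
have sx i j : exists g : {linear P i -> Y j}, g =1 submod_val s i j.
  by apply: linear_ex; exact: (is_homP s).1.
exists (fun i j => projT1 (cid (sx i j))) => i x.
have sE k j : projT1 (cid (sx k j)) =1 submod_val s k j by exact: (projT2 (cid (sx k j))).
have := @hom_diffE _ P Y 1 0 s i i x (esym (add0r 1)).
by rewrite sF FE at_in !sE expr1 scaleN1r opprK.
Qed.

End SemiProjective.

Section Bounded.
Variable S : comNzRingType.
Implicit Types (P X Y : complex S).

Definition bounded_between (l u : int) X :=
  forall i, i < l \/ u < i -> zero_mod (X i).

Lemma hom_lift P X Y (b : chain_map X Y) n (g : hom_complex P Y n) :
  (forall i, projective (P i)) -> cmap_surj b -> exists f, hom_map P b n f = g.
Proof.
move=> Pp bs; have [gl gs] := is_homP g.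
have lift i : exists h : {linear P i -> X (i + n)},
    forall x, b (i + n) (h x) = submod_val g i (i + n) x.
  have [gi giE] := linear_ex (gl i (i + n)).
  by have [h hE] := Pp i _ _ _ gi (bs (i + n)); exists h => x; rewrite hE giE.
pose h i := projT1 (cid (lift i)).
have hE i x : b (i + n) (h i x) = submod_val g i (i + n) x.
  exact: (projT2 (cid (lift i))).
have hh : @is_hom _ P X n (fun i j x => at_ (V := X) (h i x) j).
  split=> [i j a x y|i j ij x]; first by rewrite linearP (at_linear _ a (h i x)).
  by rewrite at_out // eq_sym.
have [f fE] := is_hom_ex hh; exists f; apply: hom_ext => i j x.
rewrite -[LHS]/(b j (submod_val f i j x)) fE.
have [ij|ij] := eqVneq j (i + n); last by rewrite at_out 1?eq_sym // linear0 gs.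
by subst j; rewrite at_in hE.
Qed.

Section Null.
Variables (P X Y : complex S) (b : chain_map X Y).
Hypothesis Pp : forall i, projective (P i).
Hypothesis bker : forall n (x : X n), cyc x -> b n x = 0 ->
  exists y : X (n + 1), b _ y = 0 /\ diff X (n + 1) n y = x.

Lemma lift_kernel i k (e : {linear P i -> X k}) :
  (forall x, cyc (e x)) -> (forall x, b k (e x) = 0) ->
  exists c : {linear P i -> X (k + 1)},
    (forall x, b _ (c x) = 0) /\ (forall x, diff X _ k (c x) = e x).
Proof.
move=> ec eb.
have [|A [iA [_ AP]]] := @sub_ex _ _ (fun y : X (k + 1) => b _ y = 0).
  by split=> [|a u v hu hv]; rewrite ?linear0 // linearP hu hv scaler0 addr0.
have [|B [iB [iB0 BP]]] := @sub_ex _ _ (fun y : X k => cyc y /\ b _ y = 0).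
  split=> [|a u v [cu hu] [cv hv]]; first by split; [exact: cyc0|exact: linear0].
  by split; [exact: cycL | rewrite linearP hu hv scaler0 addr0].
have [a|d dE] := @factor_inj _ _ _ _ iB (diff X (k + 1) k \o iA) iB0.
  apply/BP; split; first by apply/cyc_bnd; exists (k + 1), (iA a).
  by rewrite /= cmap_diff (AP (iA a)).2 ?linear0 //; exists a.
have [x|e' eE] := @factor_inj _ _ _ _ iB e iB0; first by apply/BP.
have ds : surj d.
  move=> y; have [cy by0] := (BP (iB y)).2 (ex_intro _ y erefl).
  have [z [/AP[a <-] zE]] := bker cy by0; exists a; apply: (linear_inj iB0).
  by rewrite dE.
have [g gE] := Pp e' ds; exists (iA \o g); split=> x /=.
  by apply/AP; exists (g x).
by rewrite -eE -gE dE.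
Qed.

(** A partial null-homotopy is extended one degree at a time: a new component
    only has to satisfy one lifting condition. *)
Lemma null_upto l u n (f : hom_complex P X n) m : bounded_between l u P ->
  cyc f -> hom_map P b n f = 0 ->
  exists h : hom_complex P X (n + 1), hom_map P b _ h = 0 /\
    forall i, i < l + m%:Z -> forall k x,
      submod_val (diff (hom_complex P X) _ n h) i k x = submod_val f i k x.
Proof.
move=> Pb cf bf; elim: m => [|m [h [bh hf]]].
  exists 0; split=> [|i il k x]; first exact: linear0.
  have -> : x = 0 by apply: (Pb i); left; rewrite addr0 in il.
  have f0 (g : hom_complex P X n) : submod_val g i k 0 = 0.
    have := (is_homP g).1 i k (- 1) 0 0.
    by rewrite scaleN1r addNr => ->; rewrite scaleN1r addNr.
  by rewrite !f0.
set i0 := l + m%:Z.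
pose e := f - diff (hom_complex P X) _ n h.
have ei i k x : i < i0 -> submod_val e i k x = 0.
  by move=> ii; rewrite -[LHS]/(submod_val f i k x - submod_val (diff _ _ n h) i k x) hf // subrr.
have ce : cyc e by apply: cycB => //; apply/cyc_bnd; exists (n + 1), h.
have ecyc k x : cyc (submod_val e i0 k x).
  suff H K : cyc (submod_val e i0 (K + 1) x) by rewrite -[k](subrK 1).
  apply/(@cycP _ X _ K) => //.
  have := @hom_diffE _ P X n (n - 1) e i0 K x (esym (subrK 1 n)).
  rewrite ce (ei (i0 - 1)); last by rewrite ltrBlDr ltrDl.
  by rewrite scaler0 subr0 => <-.
have eb k x : b k (submod_val e i0 k x) = 0.
  have bE : hom_map P b n e = 0.
    by rewrite linearB cmap_diff bf bh linear0 subrr.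
  exact: (hom_map0 b e).1 bE _ _ _.
have [g gE] := linear_ex ((is_homP e).1 i0 (i0 + n)).
have [||c [bc dc]] := @lift_kernel i0 (i0 + n) g; [by move=> x; rewrite gE..|].
have [s sE] := is_hom_ex (@single_hom _ P X i0 _ (n + 1) c (esym (addrA _ _ _))).
exists (h + s); split.
  apply/hom_map0 => i j x;
  rewrite -[submod_val (h + s) i j x]/(submod_val h i j x + submod_val s i j x).
  rewrite linearD ((hom_map0 b h).1 bh) add0r sE.
  have [ii|ii] := eqVneq i0 i; last by rewrite single_outl ?linear0.
  have [jj|jj] := eqVneq (i0 + n + 1) j; last by rewrite single_outr ?linear0.
  by subst i j; rewrite single_in.
move=> i ilt k x; rewrite linearD.
rewrite -[LHS]/(submod_val (diff _ _ n h) i k x + submod_val (diff (hom_complex P X) _ n s) i k x).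
have il : i <= i0 by rewrite -ltzD1 -addrA -PoszD addn1.
have -> : submod_val (diff (hom_complex P X) (n + 1) n s) i k x =
    diff X (k + 1) k (single c i (k + 1) x).
  rewrite hom_diffE // sE [X in _ - _ *: X]single_outl ?scaler0 ?subr0 //.
  by rewrite gt_eqF // ltrBlDr ltzD1.
have [ii|ii] := eqVneq i0 i; last first.
  by rewrite single_outl // linear0 addr0 hf // lt_neqAle eq_sym ii.
subst i; have [kk|kk] := eqVneq k (i0 + n); last first.
  rewrite single_outr ?linear0 ?addr0; last by rewrite (inj_eq (addIr 1)) eq_sym.
  by rewrite (is_homP f).2 // (is_homP (diff _ _ n h)).2.
subst k; rewrite single_in dc gE.
by rewrite -[submod_val e _ _ _]/(submod_val f i0 _ x - submod_val (diff _ _ n h) i0 _ x) subrKC.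
Qed.

Lemma null_bounded l u n (f : hom_complex P X n) : bounded_between l u P ->
  cyc f -> hom_map P b n f = 0 ->
  exists h, hom_map P b (n + 1) h = 0 /\ diff (hom_complex P X) (n + 1) n h = f.
Proof.
move=> Pb cf bf.
have [h [bh hf]] := null_upto `|(u + 1 - l)%R|%N Pb cf bf.
exists h; split=> //; apply: hom_ext => i k x.
have [ui|iu] := ltP u i; last first.
  apply: hf; apply: le_lt_trans iu _; rewrite -ltrBlDl.
  by apply: (lt_le_trans _ (ler_norm _)); rewrite ltrBlDl addrC subrK ltrDl.
have -> : x = 0 by apply: (Pb i); right.
have f0 (g : hom_complex P X n) : submod_val g i k 0 = 0.
  have := (is_homP g).1 i k (- 1) 0 0.
  by rewrite scaleN1r addNr => ->; rewrite scaleN1r addNr.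
by rewrite !f0.
Qed.

End Null.

(** Projective components lift homomorphisms along a surjection degree by
    degree; for a surjective quasi-isomorphism the kernel is exact, and
    null-homotopies into it exist by induction over the finitely many degrees. *)
Lemma bounded_semi_projective l u P :
  bounded_between l u P -> (forall i, projective (P i)) -> semi_projective P.
Proof.
move=> Pb Pp X Y b bs bq.
have hs : cmap_surj (hom_map P b) by move=> n g; exact: hom_lift.
split=> //; apply/cmap_surj_kernel => // n f cf bf.
exact: null_bounded ((cmap_surj_kernel bs).1 bq) _ _ _ f Pb cf bf.
Qed.

End Bounded.

(** * Projectivity relative to a sequence of annihilators *)

Section Free.
Variable S : comNzRingType.
Implicit Types (U V W F : lmodType S).

Lemma free_lift (T : choiceType) V (f : T -> V) :
  exists g : {linear {freeg T / S} -> V}, forall t, g (Freeg [:: (1, t)]) = f t.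
Proof.
have lg : linear (fglift f).
  have addg (D E : {freeg T / S}) : fglift f (D - E) = fglift f D - fglift f E.
    exact: (lift_is_additive f D E).
  have g0 : fglift f 0 = 0 by rewrite -(subrr 0) addg subrr.
  have gD (D E : {freeg T / S}) : fglift f (D + E) = fglift f D + fglift f E.
    have gN : fglift f (- E) = - fglift f E by rewrite -sub0r addg g0 sub0r.
    by rewrite -{1}[E]opprK addg gN opprK.
  have gsum (I : Type) (r : seq I) (F : I -> {freeg T / S}) :
      fglift f (\sum_(i <- r) F i) = \sum_(i <- r) fglift f (F i).
    by elim: r => [|i r IH]; rewrite ?big_nil // !big_cons gD IH.
  move=> a D E; rewrite gD; congr (_ + _).
  have -> : a *: D = \sum_(t <- dom D) Freeg [:: (a * coeff t D, t)] by [].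
  rewrite -[D in RHS]freeg_sumE !gsum scaler_sumr.
  by apply: eq_bigr => t _; rewrite !liftU scalerA.
have [g gE] := linear_ex lg; exists g => t; rewrite gE.
by rewrite liftU scale1r.
Qed.

Lemma free_decomp (T : choiceType) V (g : {linear {freeg T / S} -> V}) D :
  g D = \sum_(t <- dom D) coeff t D *: g (Freeg [:: (1, t)]).
Proof.
rewrite -{1}(freeg_sumE D) linear_sum; apply: eq_bigr => t _.
rewrite -linearZ; congr (g _); apply/eqP/freeg_eqP => u /=.
by rewrite coeffZ !coeffU mul1r.
Qed.

Lemma free_projective (T : choiceType) : projective ({freeg T / S} : lmodType S).
Proof.
move=> U V b f /choice[s sK].
have [g gE] := free_lift (fun t => s (f (Freeg [:: (1, t)]))).
exists g => D; rewrite (free_decomp g) (free_decomp f) linear_sum.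
by apply: eq_bigr => t _; rewrite linearZ /= gE sK.
Qed.

End Free.

Section Relative.
Variable R : comNzRingType.
Implicit Types (s : seq R) (U V W Q K : lmodType R) (a : R).

Definition killed s V := forall a (v : V), a \in s -> a *: v = 0.

Definition relproj s V := killed s V /\
  forall U W (b : {linear U -> W}) (f : {linear V -> W}), killed s U -> killed s W ->
    surj b -> exists g : {linear V -> U}, forall v, b (g v) = f v.

(** Membership in the submodule [s V], by recursion on [s] because the
    regular sequence is processed one element at a time. *)
Fixpoint imul s V (v : V) : Prop :=
  if s is a :: s' then exists u, imul s' (v - a *: u) else v = 0.

Lemma imul_rcons s a V (v : V) : imul (rcons s a) v <-> exists u, imul s (v - a *: u).
Proof.
elim: s v => [|b s IH] v; first by split=> -[u /= h]; exists u.
split=> [[w /= /IH[u h]]|[u [w h]]].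
  by exists u, w; rewrite addrAC.
by exists w; apply/IH; exists u; rewrite addrAC.
Qed.

Lemma imul0 s V : imul s (0 : V).
Proof. by elim: s => //= a s IH; exists 0; rewrite scaler0 subr0. Qed.

Lemma imulL s V a (u v : V) : imul s u -> imul s v -> imul s (a *: u + v).
Proof.
elim: s u v => [|b s IH] u v /=; first by move=> -> ->; rewrite scaler0 addr0.
move=> [u' hu] [v' hv]; exists (a *: u' + v').
suff -> : a *: u + v - b *: (a *: u' + v') = a *: (u - b *: u') + (v - b *: v').
  exact: IH.
by rewrite scalerBr scalerDr !scalerA [b * a]mulrC opprD addrACA.
Qed.

Lemma imul_closed s V : closed_prop (@imul s V).
Proof. by split; [exact: imul0 | exact: imulL]. Qed.

Lemma imul_mem s V a (v : V) : a \in s -> imul s (a *: v).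
Proof.
elim: s => //= b s IH; rewrite inE => /predU1P[->|/IH h].
  by exists v; rewrite subrr; exact: imul0.
by exists 0; rewrite scaler0 subr0.
Qed.

Lemma imul_map s V W (f : {linear V -> W}) v : imul s v -> imul s (f v).
Proof.
elim: s v => [|b s IH] v /=; first by move=> ->; rewrite linear0.
by move=> [u /IH h]; exists (f u); rewrite -linearZ -linearB.
Qed.

Lemma imul_killed s V (v : V) : killed s V -> imul s v -> v = 0.
Proof.
elim: s v => [|b s IH] v //= ks [u].
rewrite (ks b) ?mem_head // subr0; apply: IH => a w sa.
by apply: ks; rewrite inE sa orbT.
Qed.

Lemma imul_gen_ideal s (r : R) : r \in gen_ideal s <-> imul s (r : R^o).
Proof.
elim: s r => [|b s IH] r.
  split=> [/asboolP[c ->]|->]; first by rewrite big_ord0.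
  by apply/asboolP; exists (fun=> 0); rewrite big_ord0.
split=> [/asboolP[c ->]|[u /IH/asboolP[c rE]]].
  exists (c ord0); apply/IH/asboolP; exists (fun i => c (fintype.lift ord0 i)).
  by rewrite big_ord_recl /= mulrC addrAC subrr add0r.
apply/asboolP; exists (fun i => if unlift ord0 i is Some j then c j else u).
rewrite big_ord_recl unlift_none /= -[LHS](subrK (b *: (u : R^o))) rE addrC mulrC.
by congr (_ + _); apply: eq_bigr => i _; rewrite liftK.
Qed.

Lemma killed_inj s V W (i : {linear V -> W}) :
  (forall v, i v = 0 -> v = 0) -> killed s W -> killed s V.
Proof. by move=> i0 kW a v sa; apply: i0; rewrite linearZ /= kW. Qed.

Lemma killed_quot s V Q (q : {linear V -> Q}) :
  surj q -> (forall v, imul s v -> q v = 0) -> killed s Q.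
Proof.
by move=> qs q0 a w sa; have [v <-] := qs w; rewrite -linearZ q0 //; exact: imul_mem.
Qed.

Lemma relproj_nil V : relproj [::] V <-> projective V.
Proof.
split=> [[_ H] U W b f bs|H]; first by apply: H => // ? ?.
by split=> // U W b f _ _; exact: H.
Qed.

Lemma relproj_zero s V : zero_mod V -> relproj s V.
Proof.
move=> V0; split=> [a v _|U W b f _ _ _]; first exact: V0.
by exists \0 => v; rewrite (V0 v) !linear0.
Qed.

Definition regular_on a V := forall v : V, a *: v = 0 -> v = 0.

Definition regular_mod s a := forall r : R, r * a \in gen_ideal s -> r \in gen_ideal s.

(** Coordinates on a free module reduce regularity on a projective module to
    regularity on the ring. *)
Lemma projective_regular s a V (v : V) : projective V -> regular_mod s a ->
  imul s (a *: v) -> imul s v.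
Proof.
move=> Vp reg av; have [p pE] := free_lift (id : V -> V).
have ps : surj p by move=> w; exists (Freeg [:: (1, w)]).
have [t tE] := Vp _ _ p idfun ps.
have -> : v = p (t v) by rewrite tE.
rewrite (free_decomp p).
elim: (dom _) => [|z d IH]; first by rewrite big_nil; exact: imul0.
rewrite big_cons -[X in X + _]scale1r; apply: imulL => //.
have [c cE] : exists c : {linear V -> R^o}, forall w, c w = coeff z (t w).
  by apply: linear_ex => b u w; rewrite linearP coeffD coeffZ.
have [m mE] : exists m : {linear R^o -> V}, forall r, m r = r *: p (Freeg [:: (1, z)]).
  by apply: linear_ex => b u w; rewrite scalerDl scalerA.
rewrite -cE -mE; apply: imul_map; apply/imul_gen_ideal/reg/imul_gen_ideal.
have := imul_map c av; rewrite linearZ /=.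
by rewrite mulrC.
Qed.

(** The zero module covers itself, so that covering preserves boundedness. *)
Lemma relproj_cover s V : killed s V -> exists U (p : {linear U -> V}),
  [/\ relproj s U, surj p, zero_mod V -> zero_mod U &
      forall a, regular_mod s a -> regular_on a U].
Proof.
move=> kV; have [V0|Vn0] := pselect (zero_mod V).
  exists V, idfun; split=> [||//|a _ v _]; [exact: relproj_zero| |exact: V0].
  by move=> v; exists v.
have [g gE] := free_lift (id : V -> V).
have [U [q [qs q0]]] := quot_ex (@imul_closed s ({freeg V / R} : lmodType R)).
have gq D : q D = 0 -> g D = 0.
  by move=> /q0/(imul_map g); exact: imul_killed.
have [p pE] := factor_surj qs gq.
have kU : killed s U by apply: (killed_quot qs) => v /q0.
exists U, p; split=> //; first last.
- move=> a reg u; have [D <-] := qs u; rewrite -linearZ => /q0 aD.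
  by apply/q0; exact: projective_regular (@free_projective R V) reg aD.
- by move=> v; exists (q (Freeg [:: (1, v)])); rewrite pE gE.
split=> // A B b f kA kB bs.
have [h hE] := free_projective (f \o q) bs.
have hq D : q D = 0 -> h D = 0.
  by move=> /q0/(imul_map h); exact: imul_killed.
have [h' h'E] := factor_surj qs hq; exists h' => u.
by have [D <-] := qs u; rewrite h'E hE.
Qed.

Lemma killed_pair s U V : killed s U -> killed s V -> killed s (U * V)%type.
Proof.
by move=> kU kV a v sa; apply: injective_projections => /=; [exact: kU|exact: kV].
Qed.

Lemma relproj_pair s U V : relproj s U -> relproj s V -> relproj s (U * V)%type.
Proof.
move=> [kU pU] [kV pV]; split=> [|A B b f kA kB bs]; first exact: killed_pair.
have [fl flE] : exists g : {linear U -> B}, forall u, g u = f (u, 0).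
  apply: linear_ex => a u v; rewrite -linearP; congr (f _).
  by apply: injective_projections => //=; rewrite scaler0 addr0.
have [fr frE] : exists g : {linear V -> B}, forall u, g u = f (0, u).
  apply: linear_ex => a u v; rewrite -linearP; congr (f _).
  by apply: injective_projections => //=; rewrite scaler0 addr0.
have [gl glE] := pU _ _ b fl kA kB bs; have [gr grE] := pV _ _ b fr kA kB bs.
have [g gE] : exists g : {linear (U * V)%type -> A}, forall x, g x = gl x.1 + gr x.2.
  by apply: linear_ex => a x y; rewrite !linearP scalerDr addrACA.
exists g => x; rewrite gE linearD glE grE flE frE -linearD; congr (f _).
by case: x => x y; apply: injective_projections => /=; rewrite ?addr0 ?add0r.
Qed.

(** The map [U / a U -> V] splits, so [U] projects onto [K] modulo [a U] by
    some [k]; for [y] in [K] the error [y - k y] is [a] times a unique element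
    [w y] of [U], which makes [K] a retract of [U + U]. *)
Lemma relproj_kernel s a U V K (p : {linear U -> V}) (i : {linear K -> U}) :
  relproj s U -> regular_on a U -> relproj (rcons s a) V -> surj p ->
  (forall y, i y = 0 -> y = 0) -> (forall u, p u = 0 <-> exists y, i y = u) ->
  relproj s K.
Proof.
move=> [kU pU] ra [kV pV] ps i0 iP.
have kVs : killed s V by move=> b v sb; apply: kV; rewrite mem_rcons inE sb orbT.
have aV v : a *: v = 0 :> V by apply: kV; rewrite mem_rcons mem_head.
have pi y : p (i y) = 0 by apply/iP; exists y.
have kK : killed s K by exact: (killed_inj i0 kU).
have [|Q [q [qs q0]]] := @quot_ex _ U (fun u => exists w, a *: w = u).
  split=> [|b _ _ [u <-] [v <-]]; first by exists 0; rewrite scaler0.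
  by exists (b *: u + v); rewrite scalerDr !scalerA mulrC.
have kQs : killed s Q.
  by move=> b w sb; have [u <-] := qs w; rewrite -linearZ /= kU ?linear0.
have kQ : killed (rcons s a) Q.
  move=> b w; rewrite mem_rcons inE => /predU1P[->|/kQs]; last exact.
  by have [u <-] := qs w; rewrite -linearZ; apply/q0; exists u.
have [|pq pqE] := @factor_surj _ _ _ _ q p qs.
  by move=> _ /q0[w <-]; rewrite linearZ /= aV.
have pqs : surj pq by move=> v; have [u <-] := ps v; exists (q u).
have [t tE] := pV _ _ pq idfun kQ kV pqs.
have [|W [j [j0 jP]]] := @sub_ex _ Q (fun w => pq w = 0).
  by split=> [|b u v hu hv]; rewrite ?linear0 // linearP hu hv scaler0 addr0.
have kW : killed s W by exact: (killed_inj j0 kQs).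
have [|qK qKE] := @factor_inj _ _ _ _ j (q \o i) j0.
  by move=> y; apply/jP; rewrite /= pqE.
have qKs : surj qK.
  move=> w; have [u uw] := qs (j w).
  have : p u = 0 by rewrite -pqE uw; apply/jP; exists w.
  by move=> /iP[y yu]; exists y; apply: (linear_inj j0); rewrite qKE /= yu.
have [f0 f0E] : exists f : {linear U -> Q}, forall u, f u = q u - t (p u).
  apply: linear_ex => b u v.
  by rewrite !linearP /= scalerBr scalerN addrACA.
have [|f fE] := @factor_inj _ _ _ _ j f0 j0.
  by move=> u; apply/jP; rewrite f0E linearB pqE tE subrr.
(* [f] sends [u] to its component in [W = K / a U]; [k] lifts it to [K]. *)
have [k kE] := pU _ _ qK f kK kW qKs.
have [r rE] : exists r : {linear K -> U}, forall y, r y = i y - i (k (i y)).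
  by apply: linear_ex => b u v; rewrite !linearP /= scalerBr scalerN addrACA.
have [am amE] : exists m : {linear U -> U}, forall u, m u = a *: u.
  by apply: linear_ex => b u v; rewrite scalerDr !scalerA mulrC.
have [||w wE] := @factor_inj _ _ _ _ am r.
- by move=> u; rewrite amE; exact: ra.
- move=> y; suff /q0[z zy] : q (r y) = 0 by exists z; rewrite amE.
  rewrite rE linearB; have := qKE (k (i y)); rewrite kE fE f0E pi linear0 subr0.
  by move=> /= <-; rewrite subrr.
have [|m mE] := @factor_inj _ _ _ _ i am i0.
  by move=> u; apply/iP; rewrite amE linearZ /= aV.
have yE y : y = k (i y) + m (w y).
  by apply: (linear_inj i0); rewrite linearD mE wE rE subrKC.
split=> // A B b g kA kB bs.
have [g1 g1E] := pU _ _ b (g \o k) kA kB bs.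
have [g2 g2E] := pU _ _ b (g \o m) kA kB bs.
have [h hE] : exists h : {linear K -> A}, forall y, h y = g1 (i y) + g2 (w y).
  by apply: linear_ex => c u v; rewrite !linearP scalerDr addrACA.
by exists h => y; rewrite hE linearD g1E g2E /= -linearD -yE.
Qed.

End Relative.

(** * Changing rings along one regular element *)

Section ChangeRings.
Variable R : comNzRingType.
Implicit Types (s : seq R) (T X : complex R) (M : lmodType R).

Lemma disc_cyc (U : int -> lmodType R) n (z : disc U n) : cyc z -> z.1 = 0.
Proof.
move=> /(_ (n - 1)) /=; rewrite disc_diffE => -[].
have : n = n - 1 + 1 by rewrite subrK.
by move: (n - 1 + 1) => m nm; subst m; rewrite at_in.
Qed.

(** The complex [T] is covered by a contractible complex [disc U] of modules
    that are projective relative to [s]; the kernel of the cover carries the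
    homology of [T], shifted by one degree. *)
Lemma relproj_step s a l u T M b : regular_mod s a -> bounded_between l u T ->
  (forall n, relproj (rcons s a) (T n)) -> homology_powers T M b ->
  exists K, [/\ bounded_between (l - 1) u K, forall n, relproj s (K n) &
    homology_powers K M (fun n => b (n + 1))].
Proof.
move=> reg Tb Tp Th.
have Tk n : killed s (T n).
  by move=> c v sc; apply: (Tp n).1; rewrite mem_rcons inE sc orbT.
pose U n := projT1 (cid (relproj_cover (Tk n))).
pose p n : {linear U n -> T n} := projT1 (cid (projT2 (cid (relproj_cover (Tk n))))).
have UP n : [/\ relproj s (U n), surj (p n), zero_mod (T n) -> zero_mod (U n) &
    forall a, regular_mod s a -> regular_on a (U n)].
  exact: projT2 (cid (projT2 (cid (relproj_cover (Tk n))))).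
have [w wE] : exists w : forall n, {linear disc U n -> T n},
    forall n x, w n x = p n x.1 + diff T (n + 1) n (p (n + 1) x.2).
  have wx n : exists w : {linear disc U n -> T n},
      forall x, w x = p n x.1 + diff T (n + 1) n (p (n + 1) x.2).
    by apply: linear_ex => c x y; rewrite !linearP scalerDr addrACA.
  by exists (fun n => projT1 (cid (wx n))) => n x; exact: (projT2 (cid (wx n)) x).
have ws n : surj (w n).
  move=> t; have [_ /(_ t)[x xt] _ _] := UP n.
  by exists (x, 0); rewrite wE xt !linear0 addr0.
have [n|i j x wx|K [k [k0 kP]]] := @subcomplex_ex R (disc U) (fun n x => w n x = 0).
- by split=> [|c x y hx hy]; rewrite ?linear0 // linearP hx hy scaler0 addr0.
- rewrite wE /= disc_diffE linear0 add0r /=.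
  have [ij|ij] := eqVneq i (j + 1); last by rewrite at_out // !linear0.
  subst i; rewrite at_in; move: wx; rewrite wE => /eqP; rewrite addr_eq0 => /eqP ->.
  by rewrite linearN diff_diff oppr0.
exists K; split=> [i il|n|n].
- have Ti : zero_mod (T i).
    by apply: Tb; case: il => il; [left; apply: lt_trans il _; rewrite ltrBlDr ltrDl|right].
  have Ti1 : zero_mod (T (i + 1)).
    apply: Tb; case: il => il; first by left; rewrite -ltrBrDr.
    by right; apply: lt_trans il _; rewrite ltrDl.
  have [_ _ /(_ Ti) Ui _] := UP i; have [_ _ /(_ Ti1) Ui1 _] := UP (i + 1).
  move=> y; apply: k0; apply: injective_projections; [exact: Ui|exact: Ui1].
- have [Up _ _ Ur] := UP n; have [Up1 _ _ Ur1] := UP (n + 1).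
  apply: (@relproj_kernel _ s a (disc U n) (T n) _ (w n) (k n)) => //.
  + exact: relproj_pair.
  + move=> x ax; apply: injective_projections => /=.
      by apply: (Ur a reg); exact: (congr1 fst ax).
    by apply: (Ur1 a reg); exact: (congr1 snd ax).
  + by move=> y; exact: k0.
have [h [hl h0 hs]] := Th (n + 1).
have kw y : w n (k n y) = 0 by apply/kP; exists y.
have ky1 (y : K n) : cyc y -> (k n y).1 = 0 by move=> /(cyc_map k)/disc_cyc.
have pcyc (y : K n) : cyc y -> cyc (p (n + 1) (k n y).2).
  move=> cy; apply/(@cycP _ _ _ n) => //.
  by have := kw y; rewrite wE ky1 // linear0 add0r.
exists (fun y => h (p (n + 1) (k n y).2)); split=> [c y z cy cz|y cy|v].
- by rewrite linearP /= linearP hl //; exact: pcyc.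
- rewrite h0; last exact: pcyc.
  split=> [/(bndP _ erefl)[t tE]|/(bndP _ erefl)[y' <-]].
    have [_ /(_ t)[x xt] _ _] := UP (n + 1 + 1).
    have [y' yy] : exists y', k (n + 1) y' = ((k n y).2, - x).
      by apply/kP; rewrite wE /= linearN linearN xt tE subrr.
    exists (n + 1), y'; apply: (linear_inj (k0 n)); rewrite cmap_diff yy /=.
    by rewrite disc_diffE at_in -(ky1 _ cy); case: (k n y).
  rewrite cmap_diff /= disc_diffE at_in /=.
  have : w (n + 1) (k (n + 1) y') = 0 by apply/kP; exists y'.
  rewrite wE => /eqP; rewrite addr_eq0 => /eqP ->.
  by rewrite -linearN; exists (n + 1 + 1), (- p (n + 1 + 1) (k (n + 1) y').2).
have [z cz hz] := hs v; have [_ /(_ z)[x xz] _ _] := UP (n + 1).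
have [y yx] : exists y, k n y = (0, x).
  by apply/kP; rewrite wE linear0 add0r xz cz.
exists y; last by rewrite yx xz.
move=> j; apply: k0; rewrite cmap_diff yx /= disc_diffE.
have [nj|nj] := eqVneq n (j + 1); last by rewrite at_out.
by subst n; rewrite at_in.
Qed.

End ChangeRings.

(** * Truncation *)

Section Truncate.
Variable A : comNzRingType.
Implicit Types (P : complex A).

Lemma projective_retract (U V : lmodType A) (i : {linear V -> U}) (r : {linear U -> V}) :
  (forall v, r (i v) = v) -> projective U -> projective V.
Proof.
move=> ri Up X Y b f bs; have [g gE] := Up _ _ b (f \o r) bs.
by exists (g \o i) => v; rewrite /= gE /= ri.
Qed.

(** A single formula for all degrees: everything above [l], the cycles in
    degree [l], zero below. *)
Definition truncation P l n (x : P n) : Prop :=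
  if l < n then True else if n == l then cyc x else x = 0.

(** The quotient of [P] by its truncation is exact, so the projection to it is
    null-homotopic; the homotopy gives a retraction of [P l] onto the cycles. *)
Lemma truncate_semi_projective P l :
  semi_projective P -> (forall n (z : P n), n < l -> cyc z -> bnd z) ->
  exists (T : complex A) (t : chain_map T P),
    [/\ forall n, n < l -> zero_mod (T n), forall n, projective (T n),
        forall n x, t n x = 0 -> x = 0,
        forall n x, l <= n -> cyc x -> exists y, t n y = x &
        forall n x, l < n -> exists y, t n y = x].
Proof.
move=> sp Px.
have tc n : closed_prop (@truncation P l n).
  rewrite /truncation; case: (l < n); first by split.
  case: (n == l).
    by split; [exact: cyc0 | move=> a u v; exact: cycL].
  by split=> // a u v -> ->; rewrite scaler0 addr0.
have td i j x : @truncation P l i x -> @truncation P l j (diff P i j x).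
  have [ij|ij] := eqVneq i (j + 1); last first.
    by rewrite diff_shape //= => _; exact: (tc j).1.
  subst i; rewrite /truncation; case: (ltgtP l j) => // [jl|_ _]; last first.
    by apply/cyc_bnd; exists (j + 1), x.
  by rewrite ltzD1 leNgt jl /=; case: eqP => [_ -> //|_ ->]; exact: linear0.
have [T [t [t0 tP]]] := subcomplex_ex tc td.
have [Q [q [qs q0]]] := quotient_complex_ex tc td.
have Qx n (z : Q n) : cyc z -> bnd z.
  have [x <-] := qs n z; move=> cx; have [ln|nl] := ltP l n.
    by have -> : q n x = 0; [apply/q0; rewrite /truncation ln | exact: bnd0].
  have cdx : diff P n (n - 1) x = 0.
    have := cx (n - 1); rewrite -cmap_diff => /q0; rewrite /truncation.
    have nl1 : n - 1 < l by rewrite ltrBlDr ltzD1.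
    by rewrite ltNge (ltW nl1) lt_eqF.
  have {}cx : cyc x by apply/(@cycP _ _ _ (n - 1)); rewrite ?subrK.
  have [nl'|nl'] := eqVneq n l.
    have -> : q n x = 0; last exact: bnd0.
    by apply/q0; subst n; rewrite /truncation ltxx eqxx.
  by apply: bnd_map; apply: Px => //; rewrite lt_neqAle nl'.
have [h hE] := semi_projective_null q sp Qx.
exists T, t; split.
- move=> n nl y; apply: t0; have : truncation l (t n y) by apply/tP; exists y.
  by rewrite /truncation ltNge (ltW nl) lt_eqF.
- move=> n; have [ln|] := ltP l n.
    have [|r rE] := @factor_inj _ _ _ _ (t n) (idfun : {linear P n -> P n}) (t0 n).
      by move=> x; apply/tP; rewrite /truncation ln.
    apply: (@projective_retract _ _ (t n) r) (semi_projective_obj sp) => y.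
    by apply: (linear_inj (t0 n)); rewrite rE.
  rewrite le_eqVlt => /predU1P[nl|nl]; last first.
    move=> U V b f bs; exists \0 => y.
    suff -> : y = 0 by rewrite !linear0.
    apply: t0; have : truncation l (t n y) by apply/tP; exists y.
    by rewrite /truncation ltNge (ltW nl) lt_eqF.
  subst n; have [g gE] := @semi_projective_obj _ P (l - 1) sp _ _ (q l) (h (l - 1) l) (qs l).
  have [r0 r0E] : exists r : {linear P l -> P l},
      forall x, r x = x - g (diff P l (l - 1) x).
    by apply: linear_ex => a x y; rewrite !linearP /= scalerBr scalerN addrACA.
  have [|r rE] := @factor_inj _ _ _ _ (t l) r0 (t0 l).
    move=> x; apply/tP/q0; rewrite r0E linearB gE hE.
    suff -> : h l (l + 1) x = 0 by rewrite linear0 add0r subrr.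
    have [y <-] := qs _ (h l (l + 1) x); apply/q0.
    by rewrite /truncation ltrDl.
  apply: (@projective_retract _ _ (t l) r) (semi_projective_obj sp) => y.
  apply: (linear_inj (t0 l)); rewrite rE r0E.
  have : truncation l (t l y) by apply/tP; exists y.
  by rewrite /truncation ltxx eqxx => ->; rewrite linear0 subr0.
- exact: t0.
- move=> n x ln cx; apply/tP; rewrite /truncation.
  by case: ltgtP ln => // nl _; subst n.
- by move=> n x ln; apply/tP; rewrite /truncation ln.
Qed.

Lemma truncate_homology P l u M a :
  (forall n, u < n -> zero_mod (P n)) -> semi_projective P ->
  homology_powers P M a -> (forall n, n < l -> a n = 0%N) ->
  exists T, [/\ bounded_between l u T, forall n, projective (T n) &
    homology_powers T M a].
Proof.
move=> Pu sp Ph al.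
have Px n (z : P n) : n < l -> cyc z -> bnd z.
  move=> /al an; have [h [_ h0 _]] := Ph n; move=> /h0 <-.
  by move: (h z); rewrite an => f; exact: zero_ffun0.
have [T [t [Tl Tp t0 tc tl]]] := truncate_semi_projective sp Px.
exists T; split=> // [n [/Tl//|un y]|n].
  by apply: t0; exact: Pu.
have [nl|ln] := ltP n l.
  rewrite al //; exists (fun=> 0); split=> [c y z _ _|z _|v].
  - by rewrite scaler0 addr0.
  - by split=> // _; rewrite (Tl n nl z); exact: bnd0.
  - by exists 0; [exact: cyc0 | rewrite (zero_ffun0 v)].
have [h [hl h0 hs]] := Ph n; exists (fun y => h (t n y)).
have ct (y : T n) : cyc y -> cyc (t n y) by exact: cyc_map.
split=> [c y z /ct cy /ct cz|z cz|v].
- by rewrite linearP hl.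
- rewrite h0; last exact: ct.
  split=> [/(bndP _ erefl)[x xE]|]; last exact: bnd_map.
  have [|y yx] := tl (n + 1) x; first by rewrite ltzD1.
  by exists (n + 1), y; apply: (linear_inj (t0 n)); rewrite cmap_diff yx.
have [z cz hz] := hs v; have [y yz] := tc n z ln cz.
exists y; last by rewrite yz.
by move=> j; apply: t0; rewrite cmap_diff yz.
Qed.

End Truncate.

(** * Free resolutions and vanishing of the first Ext module *)

Section NatComplex.
Variables (S : comNzRingType) (F : nat -> lmodType S).
Variable (d : forall n, {linear F n.+1 -> F n}).
Hypothesis dd : forall n x, d n (d n.+1 x) = 0.

Definition nat_obj (i : int) : lmodType S :=
  match i with Posz n => F n | Negz _ => 'rV[S]_0 end.

Definition nat_fun (i j : int) : nat_obj i -> nat_obj j :=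
  match i, j return nat_obj i -> nat_obj j with
  | Posz n.+1, Posz m => fun x => at_ (V := F) (d n x) m
  | _, _ => fun=> 0
  end.

Fact nat_fun_linear i j : linear (@nat_fun i j).
Proof.
move: i j => [[|n]|n] [m|m] a x y; rewrite /= ?scaler0 ?addr0 //.
by rewrite linearP (at_linear _ a (d n x)).
Qed.

Definition nat_diff i j : {linear nat_obj i -> nat_obj j} :=
  projT1 (cid (linear_ex (@nat_fun_linear i j))).

Lemma nat_diffE i j x : nat_diff i j x = nat_fun j x.
Proof. exact: (projT2 (cid (linear_ex (@nat_fun_linear i j)))). Qed.

Fact nat_shape i j : i != j + 1 -> forall x, nat_diff i j x = 0.
Proof.
move=> ij x; rewrite nat_diffE; move: i j ij x => [[|n]|n] [m|m] //= ij x.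
by rewrite at_out //; apply: contra ij => /eqP ->; rewrite -PoszD addn1.
Qed.

Fact nat_diff_diff i j k x : nat_diff j k (nat_diff i j x) = 0.
Proof.
rewrite !nat_diffE; move: i j k x => [[|n]|n] [[|m]|m] [k|k] //= x;
  rewrite ?linear0 ?at_0 //.
have [nm|nm] := eqVneq n m.+1; last by rewrite [at_ (d n x) _]at_out // linear0 at_0.
by subst n; rewrite at_in dd at_0.
Qed.

Definition nat_complex : complex S := Complex nat_shape nat_diff_diff.

End NatComplex.

Section Ext.
Variable S : comNzRingType.
Implicit Types (M V W E : lmodType S).

Lemma free_cover V : exists (F : lmodType S) (p : {linear F -> V}),
  projective F /\ surj p.
Proof.
have [p pE] := free_lift (id : V -> V).
exists ({freeg V / S}), p; split; first exact: free_projective.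
by move=> v; exists (Freeg [:: (1, v)]); rewrite pE.
Qed.

Definition cover V := projT1 (cid (free_cover V)).
Definition cover_map V : {linear cover V -> V} :=
  projT1 (cid (projT2 (cid (free_cover V)))).

Lemma coverP V : projective (cover V) /\ surj (cover_map V).
Proof. exact: (projT2 (cid (projT2 (cid (free_cover V))))). Qed.

Lemma syzygy_ex V : exists (K : lmodType S) (i : {linear K -> cover V}),
  (forall k, i k = 0 -> k = 0) /\ (forall x, cover_map V x = 0 <-> exists k, i k = x).
Proof.
apply: sub_ex; split=> [|a u v hu hv]; first exact: linear0.
by rewrite linearP hu hv scaler0 addr0.
Qed.

Definition syzygy V := projT1 (cid (syzygy_ex V)).
Definition syzygy_map V : {linear syzygy V -> cover V} :=
  projT1 (cid (projT2 (cid (syzygy_ex V)))).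

Lemma syzygyP V : (forall k, syzygy_map V k = 0 -> k = 0) /\
  (forall x, cover_map V x = 0 <-> exists k, syzygy_map V k = x).
Proof. exact: (projT2 (cid (projT2 (cid (syzygy_ex V))))). Qed.

Section Resolution.
Variable V : lmodType S.

Definition res_obj n := cover (iter n syzygy V).
Definition res_diff n : {linear res_obj n.+1 -> res_obj n} :=
  syzygy_map (iter n syzygy V) \o cover_map (iter n.+1 syzygy V).

Lemma res_diff0 n x : res_diff n x = 0 <-> exists y, res_diff n.+1 y = x.
Proof.
have [s0 _] := syzygyP (iter n syzygy V).
have [_ sP] := syzygyP (iter n.+1 syzygy V).
rewrite /=; split=> [/s0/sP[k <-]|[y <-]].
  by have [y <-] := (coverP (iter n.+2 syzygy V)).2 k; exists y.
by rewrite (_ : cover_map _ _ = 0) ?linear0 //; apply/sP; eexists.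
Qed.

Lemma res_diff_diff n x : res_diff n (res_diff n.+1 x) = 0.
Proof. by apply/res_diff0; exists x. Qed.

Lemma res_aug x : cover_map V x = 0 <-> exists y, res_diff 0 y = x.
Proof.
have [_ sP] := syzygyP V; split=> [/sP[k <-]|[y <-]]; last by apply/sP; eexists.
by have [y <-] := (coverP (syzygy V)).2 k; exists y.
Qed.

Definition res := nat_complex res_diff_diff.

Definition aug_fun i : {linear res i -> mod_complex V i} :=
  match i with Posz 0 => cover_map V | _ => \0 end.

Fact aug_diff i j x : aug_fun j (diff res i j x) = diff (mod_complex V) i j (aug_fun i x).
Proof.
rewrite [RHS]/= [diff _ _ _ _]nat_diffE.
move: i j x => [[|n]|n] [[|m]|m] x //=; rewrite ?linear0 //.
have [n0|n0] := eqVneq n 0%N; last by rewrite at_out ?linear0.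
by subst n; rewrite at_in; apply/res_aug; exists x.
Qed.

Definition aug := ChainMap aug_diff.

Lemma res_projective_resolution : projective_resolution aug.
Proof.
have zr n (v : res (Negz n)) : v = 0 by exact: thinmx0.
split=> [[n|n]|[n|n] //|].
- exact: (coverP _).1.
- by move=> U W b f _; exists \0 => v; rewrite (zr n v) !linear0.
- by move=> _; exact: zr.
apply/quasi_isoP => -[[|n]|n].
- split=> [y _|x _ [i [y]]].
    have [x xy] := (coverP V).2 y; exists x; split.
      by move=> j; rewrite [LHS]nat_diffE; case: j.
    by rewrite -[aug 0 x]/(cover_map V x) xy subrr; exact: bnd0.
  move=> /esym/res_aug[z <-]; exists 1, z.
  by rewrite [LHS]nat_diffE /= at_in.
- split=> [y _|x cx _].
    exists 0; split; first exact: cyc0.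
    rewrite (_ : _ - _ = 0); first exact: bnd0.
    exact: (@mod_obj_zero _ V (Posz n.+1)).
  have := cx n%:Z; rewrite [X in X = _]nat_diffE /= at_in => /res_diff0[y <-].
  by exists n.+2, y; rewrite [LHS]nat_diffE /= at_in.
- split=> [y _|x _ _]; last by rewrite (zr n x); exact: bnd0.
  exists 0; split; first exact: cyc0.
  rewrite (_ : _ - _ = 0); first exact: bnd0.
  exact: (@mod_obj_zero _ V (Negz n)).
Qed.

End Resolution.

(** A linear map [g] on [F1] that kills the kernel of [d] is a cocycle of
    degree [-1] of homomorphisms from the free resolution to [W]; being a
    coboundary means that it factors through [d]. *)
Lemma Ext1_extend M W : Ext_eq0 1 M W -> exists (F0 F1 : lmodType S) (d : {linear F1 -> F0})
    (p : {linear F0 -> M}),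
  [/\ projective F0, surj p, forall x, p x = 0 <-> exists y, d y = x &
    forall g : {linear F1 -> W}, (forall y, d y = 0 -> g y = 0) ->
      exists G : {linear F0 -> W}, forall y, G (d y) = g y].
Proof.
move=> /(_ _ _ (res_projective_resolution M))/zero_homologyP ext.
have [cp cs] := coverP M.
exists (res_obj M 0), (res_obj M 1), (res_diff M 0), (cover_map M).
split=> // [x|g gd]; first exact: res_aug.
have [f fE] := is_hom_ex (@single_hom _ (res M) (mod_complex W) 1 0 (- 1) g erefl).
have cf : cyc f.
  apply/(@cycP _ (hom_complex _ _) _ (- 2)) => //; apply: hom_ext => i k x.
  rewrite hom_diffE // fE -[RHS]/(0 : mod_complex W k) sub0r.
  suff H j (y : res M j) : cyc y ->
      @single S (res M) (mod_complex W) 1 0 g j k y = 0.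
    by rewrite H ?scaler0 ?oppr0 //; apply: cyc_bnd; exists i, x.
  have [j1|j1] := eqVneq 1 j; last by rewrite single_outl.
  have [k0|k0] := eqVneq 0 k; last by rewrite single_outr.
  subst j k => /(_ 0); rewrite [X in X = _]nat_diffE /= at_in single_in.
  exact: gd.
have /(@bndP _ (hom_complex _ _) _ 0)[//|h hf] := ext f cf.
have [G GE] := linear_ex ((is_homP h).1 0 0).
(* The differential of a homomorphism [h] of degree [0] is [- h d] here. *)
exists (- 1 \*: G) => y; have := @hom_diffE _ (res M) (mod_complex W) 0 (- 1) h 1 0 y erefl.
rewrite hf fE single_in sub0r expr0 scale1r => ->.
rewrite -[LHS]/(- 1 *: G (res_diff M 0 y)) scaleN1r GE; congr (- _).
move: (1 - 1) (subrr (1 : int)) => j j0; subst j.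
by rewrite [diff _ _ _ _]nat_diffE /= at_in.
Qed.

(** A lift of [p] to [E], corrected on the relations by means of vanishing
    Ext, descends to a section. *)
Lemma Ext1_section M W E a (al : {linear {ffun 'I_a -> W} -> E})
    (V : lmodType S) (be : {linear E -> V}) (t : {linear M -> V}) :
  Ext_eq0 1 M W -> (forall v, al v = 0 -> v = 0) -> surj be ->
  (forall e, be e = 0 <-> exists v, al v = e) ->
  exists s : {linear M -> E}, forall m, be (s m) = t m.
Proof.
move=> /Ext1_extend[F0 [F1 [d [p [Fp ps pd ext]]]]] al0 bes bea.
have [f fE] := Fp _ _ be (t \o p) bes.
have [y|g gE] := @factor_inj _ _ _ _ al (f \o d) al0.
  by apply/bea; rewrite /= fE /= (pd (d y)).2 ?linear0 //; exists y.
have Gi (i : 'I_a) : exists G : {linear F0 -> W}, forall y, G (d y) = g y i.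
  have [gi giE] : exists gi : {linear F1 -> W}, forall y, gi y = g y i.
    by apply: linear_ex => c u v; rewrite linearP !ffunE.
  have [|G GE] := ext gi; last by exists G => y; rewrite GE giE.
  move=> y dy; rewrite giE (_ : g y = 0) ?ffunE //; apply: al0.
  by rewrite gE /= dy linear0.
have [G GE] : exists G : {linear F0 -> {ffun 'I_a -> W}},
    forall x, G x = [ffun i => projT1 (cid (Gi i)) x].
  by apply: linear_ex => c u v; apply/ffunP => i; rewrite !ffunE linearP.
have Gd y : G (d y) = g y.
  by rewrite GE; apply/ffunP => i; rewrite ffunE; exact: (projT2 (cid (Gi i))).
have [f' f'E] : exists f' : {linear F0 -> E}, forall x, f' x = f x - al (G x).
  by apply: linear_ex => c u v; rewrite !linearP /= scalerBr scalerN addrACA.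
have [|s sE] := factor_surj (f := f') ps.
  by move=> _ /pd[y <-]; rewrite f'E Gd gE subrr.
exists s => m; have [x <-] := ps m; rewrite sE f'E linearB fE.
by rewrite (bea _).2 ?subr0 //; exists (G x).
Qed.

(** Sections over the [b] coordinates of the quotient add up to a splitting. *)
Lemma Ext1_split M E a b (al : {linear {ffun 'I_a -> M} -> E})
    (be : {linear E -> {ffun 'I_b -> M}}) :
  Ext_eq0 1 M M -> (forall v, al v = 0 -> v = 0) -> surj be ->
  (forall e, be e = 0 <-> exists v, al v = e) ->
  isomorphic E {ffun 'I_(a + b) -> M}.
Proof.
move=> ext al0 bes bea.
have si (i : 'I_b) : exists s : {linear M -> E},
    forall m, be (s m) = [ffun j => if j == i then m else 0].
  have [t tE] : exists t : {linear M -> {ffun 'I_b -> M}},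
      forall m, t m = [ffun j => if j == i then m else 0].
    apply: linear_ex => c u v; apply/ffunP => j; rewrite !ffunE.
    by case: ifP; rewrite ?scaler0 ?addr0.
  by have [s sE] := Ext1_section t ext al0 bes bea; exists s => m; rewrite sE.
pose s i := projT1 (cid (si i)).
have sE i m : be (s i m) = [ffun j => if j == i then m else 0].
  exact: (projT2 (cid (si i)) m).
have [f fE] : exists f : {linear {ffun 'I_(a + b) -> M} -> E}, forall v,
    f v = al [ffun i => v (lshift b i)] + \sum_i s i (v (rshift a i)).
  apply: linear_ex => c u v; rewrite scalerDr scaler_sumr addrACA -linearZ -linearD.
  congr (al _ + _); first by apply/ffunP => i; rewrite !ffunE.
  by rewrite -big_split; apply: eq_bigr => i _; rewrite !ffunE linearP.
have bef v : be (f v) = [ffun i => v (rshift a i)].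
  rewrite fE linearD (bea _).2; last by eexists.
  rewrite add0r linear_sum; apply/ffunP => j; rewrite sum_ffunE ffunE.
  rewrite (bigD1 j) //= sE ffunE eqxx big1 ?addr0 // => i ij.
  by rewrite sE ffunE eq_sym (negPf ij).
apply: isomorphic_sym; apply: (@isomorphic_bij _ _ _ f) => [v f0|e].
  have rv i : v (rshift a i) = 0.
    by have /ffunP/(_ i) := bef v; rewrite f0 linear0 !ffunE.
  have lv : [ffun i => v (lshift b i)] = 0.
    by apply: al0; rewrite -[RHS]f0 fE big1 ?addr0 // => i _; rewrite rv linear0.
  apply/ffunP => i; rewrite ffunE -[i]splitK; case: (fintype.split i) => j /=.
    by have /ffunP/(_ j) := lv; rewrite !ffunE.
  exact: rv.
pose v0 : {ffun 'I_(a + b) -> M} := [ffun i : 'I_(a + b) =>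
  if fintype.split i is inr j then be e j else (0 : M)].
have [|u uE] := (bea (e - f v0)).1.
  rewrite linearB bef; apply/eqP; rewrite subr_eq0; apply/eqP/ffunP => j.
  by rewrite !ffunE (unsplitK (inr j)).
pose v1 : {ffun 'I_(a + b) -> M} := [ffun i : 'I_(a + b) =>
  if fintype.split i is inl j then u j else (0 : M)].
exists (v1 + v0); rewrite linearD -[RHS](subrK (f v0)) -uE; congr (_ + _).
rewrite fE big1 ?addr0; last first.
  by move=> j _; rewrite ffunE (unsplitK (inr j)) linear0.
by congr (al _); apply/ffunP => j; rewrite !ffunE (unsplitK (inl j)).
Qed.

End Ext.

(** * Killing a regular element *)

Section KillElement.
Variable R : comNzRingType.
Implicit Types (W : complex R) (M : lmodType R) (x : R).

Lemma cycle_mk (V : lmodType R) W n (f : {linear V -> W n}) :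
  (forall v, cyc (f v)) ->
  exists g : {linear V -> cycles W n}, forall v, submod_val (g v) = f v.
Proof.
move=> fc; have [i iE] : exists i : {linear cycles W n -> W n}, forall c, i c = submod_val c.
  exact: linear_ex.
have [|v|g gE] := @factor_inj _ _ _ _ i f.
- by move=> c; rewrite iE => c0; exact: val_inj.
- by have [c <-] := cyc_submod (fc v); exists c; rewrite iE.
by exists g => v; rewrite -gE iE.
Qed.

Lemma cyc_scale W n x (u : W n) : cyc u -> cyc (x *: u).
Proof. by move=> cu j; rewrite linearZ_LR cu scaler0. Qed.

(** The long exact homology sequence of [0 -> W -> W -> W' -> 0] breaks into
    short exact sequences because [x] kills the homology of [W], and these
    split because [M] has no self-extensions. *)
Lemma homology_mod_regular M a W W' (q : chain_map W W') x :
  Ext_eq0 1 M M -> (forall m : M, x *: m = 0) ->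
  cmap_surj q -> (forall n w, q n w = 0 <-> exists u, x *: u = w) ->
  (forall n, regular_on x (W n)) ->
  homology_powers W M a -> homology_powers W' M (fun n => (a n + a (n - 1)%R)%N).
Proof.
move=> ext xM qs q0 xr Wh n; apply/homology_modelP.
have xV b (v : {ffun 'I_b -> M}) : x *: v = 0.
  by apply/ffunP => i; rewrite !ffunE xM.
have [h [hl h0 hs]] := Wh n; have [h' [hl' h0' hs']] := Wh (n - 1).
have n1 : n = n - 1 + 1 by rewrite subrK.
have hb z : bnd z -> h z = 0 by move=> bz; apply/h0 => //; exact: cyc_bnd.
have hb' z : bnd z -> h' z = 0 by move=> bz; apply/h0' => //; exact: cyc_bnd.
have hB y z : cyc y -> cyc z -> h (y - z) = h y - h z.
  by move=> cy cz; rewrite addrC -scaleN1r hl // scaleN1r addrC.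
have hx u : cyc u -> h (x *: u) = 0.
  by move=> cu; rewrite -[_ *: u]addr0 hl ?xV ?hb ?addr0 //; [exact: bnd0 | exact: cyc0].
have hx' u : cyc u -> h' (x *: u) = 0.
  by move=> cu; rewrite -[_ *: u]addr0 hl' ?xV ?hb' ?addr0 //; [exact: bnd0 | exact: cyc0].
have cdiv m (u : W m) : cyc (x *: u) -> cyc u.
  by move=> cu j; apply: xr; rewrite -linearZ cu.
have [f fE] : exists f : {linear cycles W n -> homology W' n},
    forall c, f c = cls W' n (cycle_map q c).
  apply: linear_ex => b u v; rewrite -linearP; congr (cls _ _ _).
  by apply: val_inj; rewrite /= linearP.
have [hc hcE] : exists hc : {linear cycles W n -> {ffun 'I_(a n) -> M}},
    forall c, hc c = h (submod_val c).
  by apply: linear_ex => b u v; rewrite hl //; exact: submod_cyc.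
have hcs : surj hc.
  by move=> v; have [z /cyc_submod[c <-] hz] := hs v; exists c; rewrite hcE.
have [|al alE] := factor_surj (f := f) hcs.
  move=> c; rewrite hcE => /(h0 _ (submod_cyc c)) bc.
  by rewrite fE; apply/cls_eq0/bnd_map.
have al0 v : al v = 0 -> v = 0.
  have [c <-] := hcs v; rewrite alE fE => /cls_eq0/(bndP _ erefl)[y' /= yE].
  have [y yy] := qs _ y'; rewrite -yy -cmap_diff in yE.
  have [|u uE] := (q0 n (submod_val c - diff W (n + 1) n y)).1.
    by rewrite linearB yE subrr.
  have by0 : bnd (diff W (n + 1) n y) by exists (n + 1), y.
  have cu : cyc u by apply: cdiv; rewrite uE; apply: cycB (submod_cyc c) (cyc_bnd by0).
  rewrite hcE (_ : submod_val c = 1 *: (x *: u) + diff W (n + 1) n y); last first.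
    by rewrite scale1r uE subrK.
  rewrite hl ?hx ?hb ?scaler0 ?addr0 //; last exact: cyc_bnd.
  exact: cyc_scale.
(* The connecting map: a class of [W'] lifted to [w] is sent to the class of
   the [u] with [d w = x u]; such pairs [(w, u)] form a module on which both
   ends of this correspondence are linear. *)
have [|K [i [i0 iP]]] := @sub_ex R (W n * W (n - 1))%type
    (fun z => diff W n (n - 1) z.1 = x *: z.2).
  split=> [|b y z hy hz] /=; first by rewrite linear0 scaler0.
  by rewrite linearP hy hz scalerDr !scalerA mulrC.
have iD k : diff W n (n - 1) (i k).1 = x *: (i k).2 by apply/iP; exists k.
have ic2 k : cyc (i k).2.
  by apply: cdiv; apply/cyc_bnd; exists n, (i k).1.
have [g gE] : exists g : {linear K -> W' n}, forall k, g k = q n (i k).1.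
  by apply: linear_ex => b u v; rewrite !linearP.
have [k|gc gcE] := @cycle_mk _ _ _ g.
  apply/(cycP _ n1); rewrite gE -cmap_diff iD; apply/q0; by exists (i k).2.
have [p pE] : exists p : {linear K -> homology W' n}, forall k, p k = cls W' n (gc k).
  by apply: linear_ex => b u v; rewrite !linearP.
have p0 k : p k = 0 <-> bnd (q n (i k).1).
  by rewrite pE cls_eq0 gcE gE.
have ps : surj p.
  move=> e; have [c <-] := cls_surj e; have [w wE] := qs n (submod_val c).
  have [|u uE] := (q0 _ (diff W n (n - 1) w)).1.
    by rewrite cmap_diff wE submod_cyc.
  have [k kE] := (iP (w, u)).1 (esym uE).
  by exists k; rewrite pE; congr (cls _ _ _); apply: val_inj; rewrite /= gcE gE kE.
have [f' f'E] : exists f' : {linear K -> {ffun 'I_(a (n - 1)) -> M}},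
    forall k, f' k = h' (i k).2.
  by apply: linear_ex => b u v; rewrite linearP /= hl'.
have [|be beE] := factor_surj (f := f') ps.
  move=> k /p0/(bndP _ erefl)[y' yE]; have [y yy] := qs _ y'.
  rewrite -yy -cmap_diff in yE.
  have [|u uE] := (q0 n ((i k).1 - diff W (n + 1) n y)).1.
    by rewrite linearB yE subrr.
  rewrite f'E; apply: hb'; exists n, u.
  apply/eqP; rewrite -subr_eq0; apply/eqP/xr.
  by rewrite scalerBr -linearZ uE linearB diff_diff subr0 iD subrr.
apply: (Ext1_split ext al0 (be := be)) => [v|e].
  have [u cu hu] := hs' v.
  have [w wE] := (bndP (x *: u) n1).1 ((h0' _ (cyc_scale x cu)).1 (hx' u cu)).
  have [k kE] := (iP (w, u)).1 wE.
  by exists (p k); rewrite beE f'E kE.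
split=> [|[v <-]].
  have [k <-] := ps e; rewrite beE f'E => /(h0' _ (ic2 k))/(bndP _ n1)[y yE].
  have cw : cyc ((i k).1 - x *: y).
    by apply/(cycP _ n1); rewrite linearB linearZ /= yE iD subrr.
  have [c cE] := cyc_submod cw; exists (hc c); rewrite alE fE pE.
  congr (cls _ _ _); apply: val_inj; rewrite /= gcE gE cE linearB.
  by rewrite [q n (x *: y)](q0 _ _).2 ?subr0 //; exists y.
have [c <-] := hcs v; rewrite alE fE.
have [|k kE] := (iP (submod_val c, 0)).1; first by rewrite /= submod_cyc scaler0.
rewrite (_ : cls _ _ _ = p k); last first.
  by rewrite pE; congr (cls _ _ _); apply: val_inj; rewrite /= gcE gE kE.
by rewrite beE f'E kE /= hb' //; exact: bnd0.
Qed.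

End KillElement.

(** * Modules over the quotient ring *)

Section QuotientRing.
Variables (R : comNzRingType) (x : seq R) (xreg : regular_seq x).
Local Notation A := (regular_quotient xreg).
Local Notation pi := (regular_quotient_pi xreg).

Lemma pi_surj : surj pi.
Proof. by move=> a; exists (repr a); exact: reprK. Qed.

Lemma pi_eq0 r : pi r = 0 <-> r \in gen_ideal x.
Proof.
have E : (r - 0 \in regular_ideal xreg) = (pi r == pi 0) by exact: Quotient.idealrBE.
rewrite rmorph0 subr0 in E; split=> [/eqP r0|rx]; last by apply/eqP; rewrite -E.
by rewrite -E in r0.
Qed.

Local Notation restr := (restr_scalars pi).

Lemma restr_scaleE (V : lmodType A) r (v : V) : r *: (v : restr V) = pi r *: v.
Proof. by []. Qed.

Lemma restr_killed (V : lmodType A) : killed x (restr V).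
Proof.
move=> r v rx; rewrite restr_scaleE (_ : pi r = 0) ?scale0r //.
by apply/pi_eq0/imul_gen_ideal; rewrite -[r : R^o]mulr1; exact: imul_mem.
Qed.

Section RestrictMap.
Variables (U V : lmodType A) (f : {linear U -> V}).

Definition restr_map : restr U -> restr V := f.

Fact restr_map_linear : linear restr_map.
Proof. by move=> r u v; rewrite /restr_map restr_scaleE linearP. Qed.

HB.instance Definition _ :=
  GRing.isLinear.Build R (restr U) (restr V) *:%R restr_map restr_map_linear.

End RestrictMap.

Lemma linear_of_restr (U V : lmodType A) (f : U -> V) :
  (forall r u v, f (pi r *: u + v) = pi r *: f u + f v) -> linear f.
Proof. by move=> fl a u v; have [r <-] := pi_surj a. Qed.

Definition restr_complex (X : complex A) : complex R :=
  @Complex R (fun i => restr (X i)) (fun i j => restr_map (diff X i j))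
    (@diff_shape A X) (@diff_diff A X).

Definition restr_cmap (X Y : complex A) (b : chain_map X Y) :
    chain_map (restr_complex X) (restr_complex Y) :=
  @ChainMap R (restr_complex X) (restr_complex Y)
    (fun i => restr_map (b i)) (@cmap_diff A X Y b).

Lemma restr_quasi_iso (X Y : complex A) (b : chain_map X Y) :
  quasi_iso b -> quasi_iso (restr_cmap b).
Proof. by move=> /quasi_isoP qb; apply/quasi_isoP => n; exact: (qb n). Qed.

Lemma restr_homology_powers (X : complex A) (M : lmodType A) a :
  homology_powers X M a -> homology_powers (restr_complex X) (restr M) a.
Proof.
move=> H n; have [h [hl h0 hs]] := H n; exists h; split=> // r y z cy cz.
have := hl (pi r) y z cy cz => E.
apply: (etrans E); apply/ffunP => i; by rewrite !ffunE.
Qed.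

Section Descend.
Variables (V : lmodType R) (kV : killed x V).

(** [kV] is kept as a parameter, since the action of the quotient ring depends
    on it. *)
Definition descend : Type := let _ := kV in V.

HB.instance Definition _ := GRing.Zmodule.copy descend V.

Lemma pi_scale r s (v : V) : pi r = pi s -> r *: v = s *: v.
Proof.
move=> rs; apply/subr0_eq; rewrite -scalerBl; apply: (imul_killed kV).
have [m mE] : exists m : {linear R^o -> V}, forall t, m t = t *: v.
  by apply: linear_ex => b u w; rewrite scalerDl scalerA.
rewrite -mE; apply: imul_map; apply/imul_gen_ideal/pi_eq0.
by rewrite rmorphB rs subrr.
Qed.

Definition descend_scale (a : A) (v : descend) : descend :=
  projT1 (cid (pi_surj a)) *: (v : V).

Lemma descend_scaleE r (v : V) : descend_scale (pi r) v = r *: v.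
Proof. by apply: pi_scale; exact: (projT2 (cid (pi_surj (pi r)))). Qed.

Fact descend_scaleA a b v :
  descend_scale a (descend_scale b v) = descend_scale (a * b) v.
Proof.
have [r <-] := pi_surj a; have [s <-] := pi_surj b.
by rewrite -rmorphM !descend_scaleE scalerA.
Qed.
Fact descend_scale1 : left_id 1 descend_scale.
Proof. by move=> v; rewrite -(rmorph1 pi) descend_scaleE scale1r. Qed.
Fact descend_scaleDr : right_distributive descend_scale +%R.
Proof. by move=> a u v; have [r <-] := pi_surj a; rewrite !descend_scaleE -scalerDr. Qed.
Fact descend_scaleDl v : {morph descend_scale^~ v : a b / a + b}.
Proof.
move=> a b; have [r <-] := pi_surj a; have [s <-] := pi_surj b.
by rewrite -rmorphD !descend_scaleE scalerDl.
Qed.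

HB.instance Definition _ := GRing.Zmodule_isLmodule.Build A descend
  descend_scaleA descend_scale1 descend_scaleDr descend_scaleDl.

Lemma pi_descend r (v : descend) : pi r *: v = r *: (v : V).
Proof. exact: descend_scaleE. Qed.

End Descend.

Lemma projective_relproj (V : lmodType A) : projective V -> relproj x (restr V).
Proof.
move=> Vp; split=> [|U W b f kU kW bs]; first exact: restr_killed.
have [b' b'E] : exists b' : {linear descend kU -> descend kW}, forall u, b' u = b u.
  by apply: linear_ex; apply: linear_of_restr => r u v; rewrite !pi_descend linearP.
have [f' f'E] : exists f' : {linear V -> descend kW}, forall v, f' v = f v.
  apply: linear_ex; apply: linear_of_restr => r u v; rewrite pi_descend.
  exact: (linearP f r u v).
have [|g gE] := Vp _ _ b' f'; first by move=> w; have [u <-] := bs w; exists u.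
have [g' g'E] : exists g' : {linear restr V -> U}, forall v, g' v = g v.
  by apply: linear_ex => r u v; rewrite restr_scaleE linearP pi_descend.
by exists g' => v; rewrite g'E -b'E gE f'E.
Qed.

Section DescendComplex.
Variables (W : complex R) (kW : forall n, killed x (W n)).

Definition descend_diff i j : descend (@kW i) -> descend (@kW j) := diff W i j.

Fact descend_diff_linear i j : linear (@descend_diff i j).
Proof. by apply: linear_of_restr => r u v; rewrite !pi_descend /descend_diff linearP. Qed.

HB.instance Definition _ i j := GRing.isLinear.Build A
  (descend (@kW i)) (descend (@kW j)) *:%R (@descend_diff i j) (@descend_diff_linear i j).

Definition descend_complex : complex A :=
  @Complex A (fun i => descend (@kW i)) (fun i j => @descend_diff i j)
    (@diff_shape R W) (@diff_diff R W).

Lemma descend_homology_powers (M : lmodType A) a :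
  homology_powers W (restr M) a -> homology_powers descend_complex M a.
Proof.
move=> H n; have [h [hl h0 hs]] := H n; exists h; split=> // c y z cy cz.
have [r <-] := pi_surj c.
have E := hl r y z cy cz; rewrite -pi_descend in E.
apply: (etrans E); apply/ffunP => i; by rewrite !ffunE.
Qed.

Variables (P : complex R) (q : chain_map P W).
Hypotheses (qs : cmap_surj q) (q0 : forall n p, q n p = 0 -> imul x p).

Lemma pull_hom n (Y : complex A) (f : hom_complex descend_complex Y n) :
  exists F : hom_complex P (restr_complex Y) n,
    forall i j p, submod_val F i j p = submod_val f i j (q i p).
Proof.
have [fl fs] := is_homP f.
have [|F FE] := @is_hom_ex _ P (restr_complex Y) n
  (fun i j p => submod_val f i j (q i p)).
  split=> [i j r u v|i j ij p]; last exact: fs.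
  have := fl i j (pi r) (q i u) (q i v).
  by rewrite pi_descend linearP.
by exists F => i j p; rewrite FE.
Qed.

Lemma push_hom n (Y : complex A) (F : hom_complex P (restr_complex Y) n) :
  exists f : hom_complex descend_complex Y n,
    forall i j p, submod_val f i j (q i p) = submod_val F i j p.
Proof.
have [Fl Fs] := is_homP F.
have fx i j : exists f : {linear W i -> restr (Y j)},
    forall p, f (q i p) = submod_val F i j p.
  have [g gE] := linear_ex (Fl i j).
  have [|f fE] := factor_surj (f := g) (@qs i).
    move=> p /q0/(imul_map g); exact/imul_killed/restr_killed.
  by exists f => p; rewrite fE gE.
pose f i j := projT1 (cid (fx i j)).
have fE i j p : f i j (q i p) = submod_val F i j p by exact: (projT2 (cid (fx i j)) p).
have [|g gE] := @is_hom_ex _ descend_complex Y n (fun i j w => f i j w).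
  split=> [i j|i j ij w].
    apply: linear_of_restr => r u v; rewrite pi_descend.
    exact: (linearP (f i j) r u v).
  by have [p <-] := @qs i w; rewrite fE Fs.
by exists g => i j p; rewrite gE fE.
Qed.

(** Homomorphisms over the quotient ring out of [P / x P] are homomorphisms
    over [R] out of [P]. *)
Lemma descend_semi_projective : semi_projective P -> semi_projective descend_complex.
Proof.
move=> sp X Y b bs bq.
have [hs hq] := sp _ _ (restr_cmap b) bs (restr_quasi_iso bq).
have ext n (Z : complex A) (f g : hom_complex descend_complex Z n) :
    (forall i j p, submod_val f i j (q i p) = submod_val g i j (q i p)) -> f = g.
  by move=> fg; apply: hom_ext => i j w; have [p <-] := @qs i w.
have pull_diff n m (Z : complex A) (f : hom_complex descend_complex Z n)
    (F : hom_complex P (restr_complex Z) n) : n = m + 1 ->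
    (forall i j p, submod_val F i j p = submod_val f i j (q i p)) ->
    forall i j p, submod_val (diff (hom_complex P (restr_complex Z)) n m F) i j p =
      submod_val (diff (hom_complex descend_complex Z) n m f) i j (q i p).
  move=> nm Ff i j p; rewrite !hom_diffE // !Ff.
  rewrite [X in _ = _ - _ *: submod_val f _ _ X](_ : _ = q _ (diff P i (i - 1) p)); last first.
    by rewrite cmap_diff.
  by rewrite restr_scaleE rmorphXn rmorphN rmorph1.
have hs' : cmap_surj (hom_map descend_complex b).
  move=> n g; have [G GE] := pull_hom g; have [F FE] := hs n G.
  have [f fE] := push_hom F; exists f; apply: ext => i j p.
  rewrite -GE -FE -[LHS]/(b j (submod_val f i j (q i p))) fE.
  by [].
split=> //; apply/cmap_surj_kernel => // n f cf bf.
have [F FE] := pull_hom f.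
have cF : cyc F.
  apply/(@cycP _ (hom_complex _ _) _ (n - 1)); first by rewrite subrK.
  apply: hom_ext => i j p; rewrite (pull_diff _ _ _ f) ?subrK // cf.
  by [].
have [|H [bH dH]] := (cmap_surj_kernel hs).1 hq n F cF.
  by apply/hom_map0 => i j p; rewrite FE; exact: ((hom_map0 b f).1 bf).
have [h hE] := push_hom H; exists h; split.
  apply/hom_map0 => i j w; have [p <-] := @qs i w; rewrite hE.
  exact: ((hom_map0 (restr_cmap b) H).1 bH).
by apply: ext => i j p; rewrite -(pull_diff _ _ _ h H) ?dH ?FE // => *; rewrite hE.
Qed.

End DescendComplex.

End QuotientRing.

(** * Passage between the ring and its quotient *)

Section Assembly.
Variables (R : comNzRingType) (x : seq R) (xreg : regular_seq x).
Local Notation A := (regular_quotient xreg).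
Local Notation restr := (restr_scalars (regular_quotient_pi xreg)).

Lemma finite_support_shift a :
  finite_support_below a -> finite_support_below (fun n => a (n + 1)).
Proof.
move=> [[l al] [n an]]; split; last by exists (n - 1); rewrite subrK.
by exists (l - 1) => m ml; apply: al; rewrite -ltrBrDr.
Qed.

Lemma finite_support_add a :
  finite_support_below a -> finite_support_below (fun n => (a n + a (n - 1)%R)%N).
Proof.
move=> [[l al] [n an]]; split; last by exists n; case: (a n) an.
exists l => m ml; rewrite !al //; apply: lt_trans ml; by rewrite ltrBlDr ltrDl.
Qed.

(** Each regular element kills the homology of the previous quotient, whose
    homology is given by powers of [M]; at every step [a] becomes the sum of
    [a] and its shift. *)
Lemma quotient_by_sequence i (P : complex R) (M : lmodType A) a : (i <= size x)%N ->
  Ext_eq0 1 (restr M) (restr M) -> (forall n, projective (P n)) ->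
  finite_support_below a -> homology_powers P (restr M) a ->
  exists (W : complex R) (q : chain_map P W),
    [/\ cmap_surj q, forall n p, q n p = 0 <-> imul (take i x) p &
      exists2 b, finite_support_below b & homology_powers W (restr M) b].
Proof.
move=> ix ext Pp asupp Ph; elim: i ix => [_|i IH ix].
  exists P, (@ChainMap _ P P (fun n => idfun) (fun _ _ _ => erefl)).
  rewrite take0; split=> [n p|n p|]; [by exists p | by [] | by exists a].
have [W [q [qs q0 [b bsupp Wh]]]] := IH (ltnW ix).
set c := x`_i; have cx : c \in x by exact: mem_nth.
have [n|j k w [u <-]|W' [q' [qs' q0']]] :=
  @quotient_complex_ex R W (fun n w => exists u, c *: u = w).
- split=> [|r _ _ [u <-] [v <-]]; first by exists 0; rewrite scaler0.
  by exists (r *: u + v); rewrite scalerDr !scalerA mulrC.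
- by exists (diff W j k u); rewrite linearZ.
have [f fE] : exists f : chain_map P W', forall n p, f n p = q' n (q n p).
  have fd j k p : (q' k \o q k) (diff P j k p) = diff W' j k ((q' j \o q j) p).
    by rewrite /= !cmap_diff.
  by exists (@ChainMap _ P W' (fun n => q' n \o q n) fd).
exists W', f; split=> [n w|n p|].
- have [v <-] := qs' n w; have [p <-] := qs n v; by exists p; rewrite fE.
- rewrite fE q0' (take_nth 0) // imul_rcons; split=> -[u hu].
    have [v vu] := qs n u; exists v; apply/q0.
    by rewrite linearB linearZ /= vu hu subrr.
  by exists (q n u); apply/esym/subr0_eq; rewrite -linearZ -linearB; apply/q0.
exists (fun n => (b n + b (n - 1)%R)%N); first exact: finite_support_add.
apply: (homology_mod_regular ext _ qs' q0') Wh => [m|n w cw].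
  exact: restr_killed.
have [p pw] := qs n w; rewrite -pw in cw *; apply/q0.
apply: (@projective_regular _ _ c) => //; first exact: xreg.1.
by apply/q0; rewrite linearZ.
Qed.

(** The elements of the sequence are released from the last to the first, each
    at the cost of one degree below and a shift of the homology. *)
Lemma lift_by_sequence i (T : complex R) (M : lmodType R) l u a : (i <= size x)%N ->
  bounded_between l u T -> (forall n, relproj x (T n)) ->
  finite_support_below a -> homology_powers T M a ->
  exists l' (K : complex R), [/\ bounded_between l' u K,
    forall n, relproj (take (size x - i) x) (K n) &
    exists2 b, finite_support_below b & homology_powers K M b].
Proof.
move=> ix Tb Tp asupp Th; elim: i ix => [_|i IH ix].
  by exists l, T; rewrite subn0 take_size; split=> //; exists a.
have [l' [K [Kb Kp [b bsupp Kh]]]] := IH (ltnW ix).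
have jx : (size x - i.+1 < size x)%N by rewrite ltn_subrL (leq_ltn_trans _ ix).
have jE : (size x - i)%N = (size x - i.+1).+1 by rewrite subnSK.
have reg : regular_mod (take (size x - i.+1) x) x`_(size x - i.+1) by exact: xreg.1.
rewrite jE in Kp.
have Kp' n : relproj (rcons (take (size x - i.+1) x) x`_(size x - i.+1)) (K n).
  by have := Kp n; rewrite (take_nth 0).
have [K' [Kb' Kp'' Kh']] := relproj_step reg Kb Kp' Kh.
exists (l' - 1), K'; split=> //; exists (fun n => b (n + 1)) => //.
exact: finite_support_shift.
Qed.

Lemma qpd_quotient (M : lmodType A) : ~ zero_mod M ->
  Ext_eq0 1 (restr M) (restr M) ->
  (qpd (mod_complex (restr M)) < +oo)%E <-> (qpd (mod_complex M) < +oo)%E.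
Proof.
move=> Mnz ext; have Mnz' : ~ zero_mod (restr M) by [].
rewrite (qpd_finiteP Mnz) (qpd_finiteP Mnz').
split=> [[P [[u Pu] sp [a asupp Ph]]]|[P [[u Pu] sp [a asupp Ph]]]].
  have Pp n : projective (P n) by exact: semi_projective_obj.
  have [W [q [qs q0 [b bsupp Wh]]]] :=
    quotient_by_sequence (leqnn _) ext Pp asupp Ph.
  rewrite take_size in q0.
  have kW n : killed x (W n) by apply: killed_quot (qs n) _ => p /q0.
  exists (descend_complex xreg kW); split.
  - exists u => v /Pu Pv w; have [p <-] := qs v w; by rewrite (Pv p) linear0.
  - by apply: (descend_semi_projective kW qs) => // n p /q0.
  - by exists b => //; exact: descend_homology_powers.
have [[l al] _] := asupp.
have [T [Tb Tp Th]] := truncate_homology Pu sp Ph al.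
have [||||l' [K [Kb Kp [b bsupp Kh]]]] :=
  @lift_by_sequence (size x) (restr_complex T) (restr M) l u a _ _ _ asupp.
- by [].
- exact: Tb.
- by move=> n; exact: projective_relproj.
- exact: restr_homology_powers.
rewrite subnn take0 in Kp; exists K; split.
- by exists u => v uv; apply: Kb; right.
- by apply: bounded_semi_projective Kb _ => n; apply/relproj_nil.
- by exists b.
Qed.

End Assembly.

Theorem corollary6p4 (R : comNzRingType) (Rnoeth : noetherian R)
    (Rlocal : local_ring R) (d : nat) (x : d.-tuple R) (xreg : regular_seq x)
    (M : lmodType (regular_quotient xreg)) (Mnz : ~ zero_mod M)
    (Mfg : fin_gen M)
    (hExt : Ext_eq0 1 (restr_scalars (regular_quotient_pi xreg) M)
                      (restr_scalars (regular_quotient_pi xreg) M)) :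
  (qpd (mod_complex (restr_scalars (regular_quotient_pi xreg) M)) < +oo)%E <->
  (qpd (mod_complex M) < +oo)%E.
Proof. exact: qpd_quotient. Qed.
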